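(* Let $\lambda\in\mathcal M$ and $\mu$ be nonzero finite even Borel measures on $S^{n-1}$ not concentrated on any great subsphere, and let $\Psi\in\mathcal C$ with $\Psi(\xi,t)=\Psi(-\xi,t)$ for all $(\xi,t)$. (i) If $\Psi\in\mathscr G_I$, then there exists $K\in\mathscr K^n_e$ with $\frac{\mu}{|\mu|}=\frac{\widetilde J_{\Psi,\lambda}(K,\cdot)}{\widetilde J_{\Psi,\lambda}(K,S^{n-1})}$. If in addition $\lambda$ is strictly positive on nonempty open subsets of $S^{n-1}$, then for a nonzero finite even Borel measure $\mu$, being not concentrated on any great subsphere is also necessary for this identity to hold for some $K\in\mathscr K^n_e$. (ii) If in addition $\mu$ vanishes on great subspheres, there is a constant $C\in(-\infty,\infty)$ with $\inf_{v\in S^{n-1}}\int_{S^{n-1}}\log|v\cdot\xi|\,d\lambda(\xi)>C$, and $\Psi\in\mathcal C_d$, then there exists $K\in\mathscr K^n_e$ with $\frac{\mu}{|\mu|}=\frac{\widetilde J_{\Psi,\lambda}(K,\cdot)}{\widetilde J_{\Psi,\lambda}(K,S^{n-1})}$.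
   Context: $S^{n-1}$ unit sphere of $\mathbb R^n$, $n\ge2$, $d\xi$ spherical Lebesgue measure, $|\mu|=\mu(S^{n-1})$. Even measure: $\mu(-\omega)=\mu(\omega)$. Not concentrated on any great subsphere: $\mu(S^{n-1}\setminus v^\perp)>0$ for all $v$; vanishes on great subspheres: $\mu(S^{n-1}\cap v^\perp)=0$ for all $v$. $\mathscr K^n_{(o)}$: compact convex sets with the origin in their interior; $\mathscr K^n_e$: origin-symmetric members. For $K$: $h_K(x)=\max\{x\cdot y:y\in K\}$, $\rho_K(x)=\max\{t\ge0:tx\in K\}$; $\pmb\alpha_K(\xi)$ set of outer unit normals at $\rho_K(\xi)\xi$, singleton $\{\alpha_K(\xi)\}$ a.e.; $\pmb\alpha^*_K(\omega)=\{\xi:\pmb\alpha_K(\xi)\cap\omega\ne\emptyset\}$. $\mathcal C$: $\Psi:S^{n-1}\times(0,\infty)\to\mathbb R$ with $\Psi,\Psi_t$ continuous; $\mathcal C_d=\{\Psi_t<0\}$. $\mathscr G_I$: positive $\Psi\in\mathcal C$ with, for each $u$, $\Psi_t(u,\cdot)>0$, $\lim_{t\to0^+}\Psi(u,t)=0$, $\lim_{t\to\infty}\Psi(u,t)=\infty$. $\mathcal M$: nonzero finite Borel measures absolutely continuous w.r.t. $d\xi$. $\widetilde J_{\Psi,\lambda}(K,\omega)=\int_{\pmb\alpha^*_K(\omega)}\frac{d\lambda(\xi)}{h_K(\alpha_K(\xi))\Psi_t(\alpha_K(\xi),h_K(\alpha_K(\xi)))}$. *)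

(* Defs.v *)
From HB Require Import structures.
From mathcomp Require Import all_boot all_order all_algebra.
From mathcomp Require Import all_classical all_reals all_analysis.
Set Implicit Arguments. Unset Strict Implicit. Unset Printing Implicit Defensive.
Import Order.TTheory GRing.Theory Num.Theory.
Import numFieldNormedType.Exports.
Local Open Scope classical_set_scope.
Local Open Scope ring_scope.

Section Defs.
Variables (R : realType) (n : nat).
Notation V := 'rV[R]_n.

Definition dotv (x y : V) : R := \sum_(i < n) x ord0 i * y ord0 i.

Definition sphere : set V := [set x | dotv x x = 1].

(** Borel sets of R^n: the sigma-algebra generated by the open sets.
    Borel measures on S^{n-1} are represented as Borel measures on R^n
    that vanish outside S^{n-1}. *)
Definition borelRn := g_sigma_algebraType (@open V).

Definition box (a b : V) : set V :=
  [set x | forall i : 'I_n, a ord0 i <= x ord0 i <= b ord0 i].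
Definition boxvol (a b : V) : R := \prod_(i < n) (b ord0 i - a ord0 i).
Definition lebesgue_outer (A : set V) : \bar R :=
  ereal_inf [set s | exists (a b : nat -> V),
     (forall k (i : 'I_n), a k ord0 i <= b k ord0 i) /\
     A `<=` \bigcup_k box (a k) (b k) /\
     s = (\sum_(0 <= k <oo) (boxvol (a k) (b k))%:E)%E].

Definition cone (w : set V) : set V :=
  [set y | exists t x, 0 < t <= 1 /\ w x /\ sphere x /\ y = t *: x].
Definition sph_lebesgue (w : set V) : \bar R := (n%:R%:E * lebesgue_outer (cone w))%E.

Definition great_subsphere (v : V) : set V := [set x | sphere x /\ dotv v x = 0].

Section Measures.
Variable mu : {measure set borelRn -> \bar R}.

Definition sph_measure : Prop :=
  mu (~` sphere) = 0%E /\ (0 < mu setT)%E /\ (mu setT < +oo)%E.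
Definition even_measure : Prop :=
  forall w : set borelRn, measurable w -> mu [set - x | x in w] = mu w.
Definition not_concentrated : Prop :=
  forall v, sphere v -> (0 < mu (sphere `\` great_subsphere v))%E.
Definition vanishes_on_great_subspheres : Prop :=
  forall v, sphere v -> mu (great_subsphere v) = 0%E.
Definition abs_cont_sph : Prop :=
  forall w : set borelRn, measurable w -> sph_lebesgue w = 0%E -> mu w = 0%E.
Definition positive_on_open : Prop :=
  forall U : set V, open U -> U `&` sphere !=set0 -> (0 < mu (U `&` sphere))%E.
End Measures.

Definition convex_set_Rn (K : set V) : Prop :=
  forall x y t, K x -> K y -> 0 <= t <= 1 -> K ((1 - t) *: x + t *: y).
Definition convex_body_o (K : set V) : Prop :=
  compact K /\ convex_set_Rn K /\ (K°) 0.
Definition convex_body_e (K : set V) : Prop :=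
  convex_body_o K /\ forall x, K x -> K (- x).

Definition support_fun (K : set V) (x : V) : R := sup [set dotv x y | y in K].
Definition radial_fun (K : set V) (x : V) : R := sup [set t | 0 <= t /\ K (t *: x)].

Definition normals (K : set V) (xi : V) : set V :=
  [set u | sphere u /\ forall y, K y -> dotv y u <= dotv (radial_fun K xi *: xi) u].
(** alpha_K(xi): an outer unit normal (the unique one for a.e. xi) *)
Definition alpha (K : set V) (xi : V) : V := xget 0 (normals K xi).
Definition alpha_star (K : set V) (w : set V) : set V :=
  [set xi | sphere xi /\ normals K xi `&` w !=set0].

Definition Psi_t (Psi : V -> R -> R) (u : V) (t : R) : R := derive1 (Psi u) t.
Definition domSR : set (V * R) := [set p | sphere p.1 /\ 0 < p.2].
Definition class_C (Psi : V -> R -> R) : Prop :=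
  {within domSR, continuous (fun p : V * R => Psi p.1 p.2)} /\
  (forall u t, sphere u -> 0 < t -> derivable (Psi u) t 1) /\
  {within domSR, continuous (fun p : V * R => Psi_t Psi p.1 p.2)}.
Definition class_Cd (Psi : V -> R -> R) : Prop :=
  class_C Psi /\ forall u t, sphere u -> 0 < t -> Psi_t Psi u t < 0.
Definition class_GI (Psi : V -> R -> R) : Prop :=
  class_C Psi /\
  (forall u t, sphere u -> 0 < t -> 0 < Psi u t) /\
  (forall u t, sphere u -> 0 < t -> 0 < Psi_t Psi u t) /\
  (forall u, sphere u -> Psi u t @[t --> 0^'+] --> 0) /\
  (forall u, sphere u -> Psi u t @[t --> +oo] --> +oo).

Definition Jtilde (Psi : V -> R -> R) (lambda : {measure set borelRn -> \bar R})
    (K : set V) (w : set V) : \bar R :=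
  (\int[lambda]_(xi in (alpha_star K w : set borelRn))
     (1 / (support_fun K (alpha K xi) *
           Psi_t Psi (alpha K xi) (support_fun K (alpha K xi))))%:E)%E.

Definition normalized_eq (Psi : V -> R -> R) (lambda mu : {measure set borelRn -> \bar R})
    (K : set V) : Prop :=
  Jtilde Psi lambda K sphere \is a fin_num /\ Jtilde Psi lambda K sphere != 0%E /\
  forall w : set borelRn, measurable w -> w `<=` sphere ->
    (mu w / mu setT = Jtilde Psi lambda K w / Jtilde Psi lambda K sphere)%E.

Definition logabs (v xi : V) : \bar R :=
  if dotv v xi == 0 then -oo%E else (ln `|dotv v xi|)%:E.
End Defs.
Arguments sphere {R n}. Arguments domSR {R n}.

(* Main.v *)
Require Import Defs.
From HB Require Import structures.
From mathcomp Require Import all_boot all_order all_algebra.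
From mathcomp Require Import all_classical all_reals all_analysis.
From mathcomp Require Import measurable_realfun ring lra.
Import Order.TTheory GRing.Theory Num.Theory.
Import numFieldNormedType.Exports.
Set Implicit Arguments. Unset Strict Implicit. Unset Printing Implicit Defensive.
Local Open Scope classical_set_scope.
Local Open Scope ring_scope.

(* Write [h] for the support function of a symmetric body [K] and
   [N x = sup_(u in S) (u.x) / h u = 1 / rho_K x] for its gauge.  Replacing
   [Psi] by [- Psi] in case (ii) leaves the normalized identity unchanged, so
   [Psi_t > 0] may be assumed.  Minimize [int ln N dlambda] among symmetric
   bodies subject to [int Psi(u, h u) dmu <= int Psi(u, 1) dmu].  Admissible
   bodies not worse than the unit ball are uniformly bounded above and below:
   in case (i) the constraint bounds [h] above and then [lambda] bounds it
   below; in case (ii) the logarithmic integral bounds [h] below first, and then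
   the constraint bounds it above since [mu] charges no great subsphere.  Hence
   a minimizer exists by compactness (Tychonoff, for equi-Lipschitz functions).

   For an even continuous [g] perturb [h] to [h (1 + t g)] and pass to the Wulff
   shape.  At every direction [xi] with a single normal [alpha xi], the
   derivative of [ln N] at [t = 0] is [- g (alpha xi)], while the constraint
   changes at the rate [int Psi_t h g dmu]; thus
   [int g (alpha xi) dlambda = tau int Psi_t h g dmu], which is the claimed
   identity tested against [Psi_t h g].

   Directions with several normals are those where the supremum of the linear
   functionals [u / h u] is attained twice.  By monotonicity of subgradients they
   form countably many pieces of Lipschitz graphs, hence a Lebesgue null set. *)

(** The gauge, rather than the body, carries the argument. For a positive continuous [f] that is not
    a support function, the gauge of [f] is already the gauge of its Wulff shape, whereas the
    support function of that shape lies below [f]. Replacing [f] by its Wulff shape therefore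
    preserves [potential] and can only lower [energy]. Perturbations and limits may thus leave the
    class of support functions, which suits a constraint in the form of an inequality. No multiplier
    theorem is applied. Minimality yields a one-sided statement: an even [g] with negative
    constraint derivative has nonpositive integral of [g (alpha xi)]. Adding a suitable constant to
    [g] turns this into an inequality between two linear functionals, and [- g] gives equality; the
    constant function 1 fixes the factor [tau]. Even test functions suffice because both measures
    and the weight are even. The constraint level is that of the unit ball, whose potential is 0:
    the ball is admissible, and only bodies of nonpositive potential require bounds. *)

Section DotProduct.
Context {R : realType} {n : nat}.
Implicit Types x y z u v : 'rV[R]_n.

Lemma dotvC x y : dotv x y = dotv y x.
Proof. by apply: eq_bigr => i _; rewrite mulrC. Qed.

Lemma dotvDl x y z : dotv (x + y) z = dotv x z + dotv y z.
Proof. by rewrite /dotv -big_split; apply: eq_bigr => i _; rewrite mxE mulrDl. Qed.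

Lemma dotvZl t x y : dotv (t *: x) y = t * dotv x y.
Proof. by rewrite /dotv mulr_sumr; apply: eq_bigr => i _; rewrite mxE mulrA. Qed.

Lemma dotvNl x y : dotv (- x) y = - dotv x y.
Proof. by rewrite -scaleN1r dotvZl mulN1r. Qed.

Lemma dotvBl x y z : dotv (x - y) z = dotv x z - dotv y z.
Proof. by rewrite dotvDl dotvNl. Qed.

Lemma dotvDr x y z : dotv z (x + y) = dotv z x + dotv z y.
Proof. by rewrite dotvC dotvDl !(dotvC _ z). Qed.

Lemma dotvZr t x y : dotv y (t *: x) = t * dotv y x.
Proof. by rewrite dotvC dotvZl dotvC. Qed.

Lemma dotvNr x y : dotv y (- x) = - dotv y x.
Proof. by rewrite dotvC dotvNl dotvC. Qed.

Lemma dotvBr x y z : dotv z (x - y) = dotv z x - dotv z y.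
Proof. by rewrite dotvDr dotvNr. Qed.

Lemma dotv0l x : dotv 0 x = 0.
Proof. by rewrite -(scale0r (0 : 'rV[R]_n)) dotvZl mul0r. Qed.

Lemma dotvv_ge0 x : 0 <= dotv x x.
Proof. by apply: sumr_ge0 => i _; rewrite -expr2 sqr_ge0. Qed.

Lemma dotvv_gt0 x : x != 0 -> 0 < dotv x x.
Proof.
move=> x0; rewrite lt_neqAle dotvv_ge0 andbT eq_sym; apply: contra x0.
rewrite psumr_eq0 => [/allP h|i _]; last by rewrite -expr2 sqr_ge0.
apply/eqP/rowP => i; rewrite mxE; apply/eqP.
by have := h i (mem_index_enum _); rewrite /= mulf_eq0 orbb.
Qed.

Lemma dotv_delta x (i : 'I_n) : dotv x (delta_mx ord0 i) = x ord0 i.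
Proof.
rewrite /dotv (bigD1 i)//= big1 ?addr0; first by rewrite mxE !eqxx mulr1.
by move=> j ji; rewrite mxE (negbTE ji) andbF mulr0.
Qed.

Lemma sphere_delta (i : 'I_n) : sphere (delta_mx ord0 i : 'rV[R]_n).
Proof. by rewrite /sphere/= dotv_delta mxE !eqxx. Qed.

Lemma sphereN x : sphere x -> sphere (- x).
Proof. by rewrite /sphere/= dotvNl dotvNr opprK. Qed.

Lemma dotv_sphere_le1 x y : sphere x -> sphere y -> dotv x y <= 1.
Proof.
rewrite /sphere/= => sx sy.
have := dotvv_ge0 (x - y).
rewrite !dotvBl !dotvBr sx sy (dotvC y x); lra.
Qed.

Definition unitv x := (Num.sqrt (dotv x x))^-1 *: x.

Lemma sphere_unitv x : x != 0 -> sphere (unitv x).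
Proof.
move=> /dotvv_gt0 x0; rewrite /sphere/= dotvZl dotvZr mulrA -expr2 exprVn.
by rewrite sqr_sqrtr ?ltW// mulVf// gt_eqF.
Qed.

Lemma normv_coord x (i : 'I_n) : `|x ord0 i| <= `|x|.
Proof. by rewrite [leRHS]mx_normrE; apply: (le_bigmax _ (fun ij => `|x ij.1 ij.2|) (ord0, i)). Qed.

Lemma normv_le x (M : R) : 0 <= M -> (forall i, `|x ord0 i| <= M) -> `|x| <= M.
Proof.
move=> M0 h; rewrite [leLHS]mx_normrE; apply/bigmax_leP; split => // -[i j] _ /=.
by rewrite ord1.
Qed.

Lemma sphere_coord x (i : 'I_n) : sphere x -> `|x ord0 i| <= 1.
Proof.
move=> sx; rewrite ler_norml -dotv_delta lerNl -dotvNl.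
by apply/andP; split; apply: dotv_sphere_le1 => //; [exact: sphereN|exact: sphere_delta|exact: sphere_delta].
Qed.

Lemma sphere_norm x : sphere x -> `|x| <= 1.
Proof. by move=> sx; apply: normv_le => // i; exact: sphere_coord. Qed.

(** The norm on row vectors is the maximum norm, not the one induced by [dotv]; the dimension factor
    enters all later Lipschitz constants and radii from here. *)
Lemma dotv_norm x y : `|dotv x y| <= n%:R * `|x| * `|y|.
Proof.
apply: (le_trans (ler_norm_sum _ _ _)).
rewrite -mulrA mulr_natl -[X in _ *+ X]card_ord -sumr_const.
by apply: ler_sum => i _; rewrite normrM ler_pM// normv_coord.
Qed.

Lemma cvg_dotv {T : Type} (F : set_system T) {FF : Filter F} (f g : T -> 'rV[R]_n) x y :
  f @ F --> x -> g @ F --> y -> dotv (f t) (g t) @[t --> F] --> dotv x y.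
Proof.
move=> fx gy; rewrite /dotv; elim: (index_enum _) => [|i s ih].
  by rewrite big_nil; under eq_fun do rewrite big_nil; exact: cvg_cst.
rewrite big_cons; under eq_fun do rewrite big_cons.
apply: cvgD => //; apply: cvgM.
  exact: (cvg_comp _ _ fx (@coord_continuous R 1 n ord0 i x)).
exact: (cvg_comp _ _ gy (@coord_continuous R 1 n ord0 i y)).
Qed.

Lemma dotvl_continuous y : continuous (fun x : 'rV[R]_n => dotv x y).
Proof. by move=> x; apply: (@cvg_dotv _ (nbhs x)); [exact: cvg_id|exact: cvg_cst]. Qed.

Lemma dotvr_continuous y : continuous (fun x : 'rV[R]_n => dotv y x).
Proof. by under eq_fun do rewrite dotvC; exact: dotvl_continuous. Qed.

Lemma closed_sphere : closed (@sphere R n).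
Proof.
rewrite (_ : sphere = (fun x => dotv x x) @^-1` [set 1])//.
apply: closed_comp; last exact: closed_eq.
by move=> x _; apply: (@cvg_dotv _ (nbhs x)); exact: cvg_id.
Qed.

Lemma compact_sphere : compact (@sphere R n).
Proof.
apply: bounded_closed_compact; last exact: closed_sphere.
exists 1; split => // M M1 x /sphere_norm x1; exact: (le_trans x1 (ltW M1)).
Qed.

End DotProduct.

Lemma sphere_nonempty {R : realType} {m : nat} : @sphere R m.+1 !=set0.
Proof. by exists (delta_mx ord0 ord0); exact: sphere_delta. Qed.

(** * Null sets for the outer measure by box covers *)

Section BoxCovers.
Context {R : realType} {m : nat}.
Notation V := 'rV[R]_m.+1.
Implicit Types (A : set V) (e : R).

(** Nullity in a form without infimum: covers for every positive [e] pass directly to subsets and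
    countable unions. *)
Definition box_covers A e := exists a b : nat -> V,
  [/\ forall k i, a k ord0 i <= b k ord0 i, A `<=` \bigcup_k box (a k) (b k) &
      (\sum_(0 <= k <oo) (boxvol (a k) (b k))%:E <= e%:E)%E].

Lemma boxvol_ge0 (a b : V) : (forall i, a ord0 i <= b ord0 i) -> 0 <= boxvol a b.
Proof. by move=> ab; apply: prodr_ge0 => i _; rewrite subr_ge0. Qed.

Lemma lebesgue_outer_eq0 A : (forall e, 0 < e -> box_covers A e) ->
  lebesgue_outer A = 0%E.
Proof.
move=> h; apply/eqP; rewrite eq_le; apply/andP; split; last first.
  apply: le_ereal_inf_tmp => _ [a [b [ab [_ ->]]]]; apply: nneseries_ge0 => k _ _.
  by rewrite lee_fin boxvol_ge0.
apply/lee_addgt0Pr => e e0; rewrite add0e.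
have [a [b [ab Aab le_e]]] := h _ e0.
by apply: le_trans le_e; apply: ereal_inf_lbound; exists a, b.
Qed.

Lemma box_coversS A B e : A `<=` B -> box_covers B e -> box_covers A e.
Proof. by move=> AB [a [b [ab Bab le_e]]]; exists a, b; split => //; exact: subset_trans Bab. Qed.

(** The [k]-th set receives the budget [e / 2 ^ k.+1], and a bijection of [nat] with pairs turns the
    double family of boxes into one sequence. *)
Lemma box_covers_bigcup (A : nat -> set V) :
  (forall k e, 0 < e -> box_covers (A k) e) ->
  forall e, 0 < e -> box_covers (\bigcup_k A k) e.
Proof.
move=> h e e0.
have {}h k : exists ab : (nat -> V) * (nat -> V),
    [/\ forall l i, ab.1 l ord0 i <= ab.2 l ord0 i,
        A k `<=` \bigcup_l box (ab.1 l) (ab.2 l) &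
        (\sum_(0 <= l <oo) (boxvol (ab.1 l) (ab.2 l))%:E <= (e / (2 ^ k.+1)%:R)%:E)%E].
  have [|a [b [? ? ?]]] := h k (e / (2 ^ k.+1)%:R); last by exists (a, b).
  by rewrite divr_gt0// ltr0n expn_gt0.
have [ab hab] := choice h.
have /card_esym/ppcard_eqP[f] := card_nat2.
pose a k := (ab (f k).1).1 (f k).2; pose b k := (ab (f k).1).2 (f k).2.
exists a, b; split.
- by move=> k i; have [h1 _ _] := hab (f k).1; exact: h1.
- move=> x [k _ Akx]; have [_ h2 _] := hab k; have [l _ xl] := h2 _ Akx.
  by exists (f^-1%FUN (k, l)) => //=; rewrite /a /b invK ?inE.
- apply: le_trans (epsilon_trick0 xpredT (ltW e0)).
  pose v k l := (boxvol ((ab k).1 l) ((ab k).2 l))%:E.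
  have v0 k l : (0 <= v k l)%E.
    by rewrite lee_fin; apply: boxvol_ge0 => i; have [h1 _ _] := hab k; exact: h1.
  have -> : (\sum_(0 <= k <oo) (boxvol (a k) (b k))%:E =
             \sum_(0 <= k <oo) \sum_(0 <= l <oo) v k l)%E.
    rewrite nneseries_esumT; last by move=> k; exact: v0.
    rewrite -(@reindex_esum R _ _ setT setT f (fun p => v p.1 p.2)) //.
    rewrite nneseries_esumT; last by move=> k; exact: nneseries_ge0.
    under [RHS]eq_esum do rewrite nneseries_esumT//.
    rewrite (@esum_esum R _ _ setT (fun=> setT) v)//; congr esum.
    by apply/seteqP; split.
  by apply: lee_nneseries => k *; [exact: nneseries_ge0|have [_ _ h3] := hab k; exact: h3].
Qed.

(** The finite family is continued by the degenerate box at 0, the default of [nth]; its volume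
    vanishes because the dimension [m.+1] is positive. *)
Lemma box_covers_fin (I : finType) (a b : I -> V) A e :
  (forall k i, a k ord0 i <= b k ord0 i) ->
  (forall x, A x -> exists k, box (a k) (b k) x) ->
  \sum_k boxvol (a k) (b k) <= e -> box_covers A e.
Proof.
move=> ab Aab le_e.
pose s := enum I; pose c k := nth 0 (map a s) k; pose d k := nth 0 (map b s) k.
have out k : (size s <= k)%N -> c k = 0 /\ d k = 0.
  by move=> sk; rewrite /c /d !nth_default// size_map.
have inn k : (k < size s)%N -> exists x, c k = a x /\ d k = b x.
  rewrite /c /d; case: (s) => // x0 s' ks.
  by exists (nth x0 (x0 :: s') k); rewrite !(nth_map x0).
have cE x : c (index x s) = a x.
  by rewrite /c (nth_map x) ?index_mem ?mem_enum// nth_index// mem_enum.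
have dE x : d (index x s) = b x.
  by rewrite /d (nth_map x) ?index_mem ?mem_enum// nth_index// mem_enum.
exists c, d; split.
- move=> k i; have [/out[-> ->]//|ks] := leqP (size s) k.
  by have [x [-> ->]] := inn k ks.
- by move=> x /Aab[k xk]; exists (index k s) => //=; rewrite cE dE.
- rewrite (nneseries_split 0 (size s)); last first.
    move=> k _; rewrite lee_fin; apply: boxvol_ge0 => i.
    have [/out[-> ->]//|ks] := leqP (size s) k.
    by have [x [-> ->]] := inn k ks.
  rewrite [X in (_ + X)%E]eseries0 ?adde0; last first.
    move=> k; rewrite add0n => sk _; have [-> ->] := out _ sk.
    by rewrite /boxvol big_ord_recl subrr mul0r.
  rewrite add0n sumEFin lee_fin; apply: le_trans le_e.
  rewrite le_eqVlt; apply/orP; left; apply/eqP.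
  have -> : \sum_(i in I) boxvol (a i) (b i) = \sum_(i <- s) boxvol (a i) (b i) by rewrite big_enum.
  case E : s => [|x0 s0]; first by rewrite !big_nil.
  rewrite -E (big_nth x0)/= [LHS]big_nat [RHS]big_nat; apply: eq_bigr => k /andP[_ ks].
  by rewrite /c /d !(nth_map x0) // -enumT.
Qed.

(* A set that is a Lipschitz graph over a coordinate hyperplane meets each of
   the [O(N^m)] columns of a grid of mesh [1/N] in a box of volume [O(N^-(m+1))]. *)
Lemma box_covers_lipschitz_graph A (i : 'I_m.+1) (L : R) :
  0 <= L -> (forall x j, A x -> `|x ord0 j| <= 1) ->
  (forall x y, A x -> A y -> `|x ord0 i - y ord0 i| <=
     L * \sum_(j < m) `|x ord0 (lift i j) - y ord0 (lift i j)|) ->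
  forall e, 0 < e -> box_covers A e.
Proof.
move=> L0 A1 AL e e0.
(* At most [(3 * N) ^ m] columns, each holding a box of height [2 * d = 2 * L * m / N] over a cell
   of volume [N ^ - m], have total volume at most [C / N]. *)
pose C := 3 ^+ m * (2 * L * m%:R).
have C0 : 0 <= C by rewrite !mulr_ge0// exprn_ge0.
pose N := (Num.truncn (C / e)).+1; pose N' : R := N%:R.
have N0 : 0 < N' by rewrite ltr0n.
have CN : C / N' <= e.
  rewrite ler_pdivrMr// mulrC -ler_pdivrMr//; apply/ltW.
  by rewrite /N' /N truncnS_gt.
(* Coordinates are shifted by 1 into the interval from 0 to 2; the value 2 itself has index [2 * N],
   so [(2 * N).+1] indices are required. *)
pose I := {ffun 'I_m -> 'I_(2 * N).+1}.
pose cell (f : I) : set V := [set y | forall j, (f j)%:R / N' <= y ord0 (lift i j) + 1 <= (f j).+1%:R / N'].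
pose x_ (f : I) := xget 0 (A `&` cell f).
pose d := L * m%:R / N'.
have d0 : 0 <= d by rewrite /d !mulr_ge0// invr_ge0 ltW.
pose a (f : I) : V := \row_k if unlift i k is Some j then (f j)%:R / N' - 1 else x_ f ord0 i - d.
pose b (f : I) : V := \row_k if unlift i k is Some j then (f j).+1%:R / N' - 1 else x_ f ord0 i + d.
apply: (@box_covers_fin I a b).
- move=> f k; rewrite !mxE; case: unliftP => [j _|_]; last by lra.
  by rewrite lerD2r ler_pM2r ?invr_gt0// ler_nat.
- move=> x Ax.
  have fP j : (Num.truncn ((x ord0 (lift i j) + 1) * N') < (2 * N).+1)%N.
    rewrite ltnS -(ler_nat R); apply: (@le_trans _ _ ((x ord0 (lift i j) + 1) * N')).
      rewrite truncn_le// mulr_ge0 ?(ltW N0)//.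
      by have := A1 x (lift i j) Ax; rewrite ler_norml => /andP[]; lra.
    rewrite natrM ler_pM2r//.
    by have := A1 x (lift i j) Ax; rewrite ler_norml => /andP[]; lra.
  pose f : I := [ffun j => Ordinal (fP j)].
  have cf : cell f x.
    move=> j; rewrite ffunE ler_pdivrMr// ler_pdivlMr//=.
    have h0 : 0 <= (x ord0 (lift i j) + 1) * N'.
      rewrite mulr_ge0 ?(ltW N0)//.
      by have := A1 x (lift i j) Ax; rewrite ler_norml => /andP[]; lra.
    by have /andP[-> /ltW ->] := truncn_itv h0.
  have [Axf cxf] : (A `&` cell f) (x_ f) by apply: (@xgetI _ _ _ x).
  exists f => k; rewrite !mxE; case: unliftP => [j ->|->].
    by have := cf j; lra.
  suff : `|x ord0 i - x_ f ord0 i| <= d by rewrite ler_norml; lra.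
  apply: (le_trans (AL _ _ Ax Axf)).
  rewrite /d -mulrA ler_wpM2l// mulr_natl -[X in _ *+ X]card_ord -sumr_const.
  apply: ler_sum => j _; rewrite ler_norml.
  have := cf j; have := cxf j; rewrite -!natr1 !mulrDl mul1r; lra.
- have vol f : boxvol (a f) (b f) = 2 * d * N'^-1 ^+ m.
    rewrite /boxvol (bigD1_ord i)//= !mxE unlift_none.
    rewrite (eq_bigr (fun=> N'^-1)) ?prodr_const ?card_ord; first by congr (_ * _); ring.
    by move=> j _; rewrite !mxE liftK -natr1 mulrDl mul1r; ring.
  under eq_bigr do rewrite vol.
  rewrite sumr_const card_ffun !card_ord.
  apply: le_trans CN; rewrite -[leLHS]mulr_natl natrX.
  have -> : (2 * N).+1%:R ^+ m * (2 * d * N'^-1 ^+ m) = ((2 * N).+1%:R / N') ^+ m * (2 * L * m%:R) / N'.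
    by rewrite /d exprMn; ring.
  rewrite /C ler_pM2r ?invr_gt0// ler_wpM2r ?mulr_ge0//.
  apply: lerXn2r; rewrite ?nnegrE ?divr_ge0// ?(ltW N0)//.
  rewrite ler_pdivrMr// /N' -natr1 natrM.
  have : 1 <= N%:R :> R by rewrite ler1n.
  lra.
Qed.

End BoxCovers.

(** * Points where a supremum of linear functionals is attained twice *)

Section MaximizerNotUnique.
Context {R : realType} {m : nat}.
Notation V := 'rV[R]_m.+1.
Variable P : set V.

Definition maximizes (x p : V) := P p /\ forall q, P q -> dotv q x <= dotv p x.

Lemma maximizes_monotone x y p q : maximizes x p -> maximizes y q ->
  dotv (p - q) (y - x) <= 0.
Proof.
move=> [Pp px] [Pq qy]; have := px _ Pq; have := qy _ Pp.
rewrite dotvBl !dotvBr; lra.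
Qed.

(** The factor 5 leaves room for two losses: localizing [p] and [q] costs [2 * d], so coordinate [i]
    of [q0 - p0] is at least [3 * d], and absorbing the error term costs another [2 * d]. *)
Definition double_max_piece (i : 'I_m.+1) (d : R) (p0 q0 : V) : set V :=
  [set x : V | (forall j, `|x ord0 j| <= 1) /\ exists p q : V,
    [/\ maximizes x p, maximizes x q, `|p - p0| <= d, `|q - q0| <= d &
        5 * d <= q ord0 i - p ord0 i]].

Lemma dotv_lift (i : 'I_m.+1) (x y : V) :
  dotv x y = x ord0 i * y ord0 i + \sum_(j < m) x ord0 (lift i j) * y ord0 (lift i j).
Proof. by rewrite /dotv (bigD1_ord i). Qed.

(* If [p, q] maximize at [x], [p', q'] at [y], and all lie within [d] of [p0],
   [q0], then by monotonicity [|(q0 - p0).(y - x)| <= 2 d |y - x|_1]. *)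
Lemma box_covers_double_max_piece i d p0 q0 : 0 < d ->
  forall e, 0 < e -> box_covers (double_max_piece i d p0 q0) e.
Proof.
move=> d0; pose L := (`|q0 - p0| + 2 * d) / d.
have L0 : 0 <= L by rewrite divr_ge0 ?addr_ge0 ?mulr_ge0// ltW.
apply: (@box_covers_lipschitz_graph R m _ i L L0); first by move=> x j [].
move=> y x [_ [p' [q' [p'y q'y p'0 q'0 _]]]] [_ [p [q [px qx pp0 qq0 pq]]]].
pose w := q0 - p0; pose z := y - x.
have wi : 3 * d <= w ord0 i.
  have := le_trans (normv_coord (p - p0) i) pp0.
  have := le_trans (normv_coord (q - q0) i) qq0.
  by rewrite !mxE !ler_norml; lra.
pose S := \sum_(j < m) `|z ord0 (lift i j)|.
have small (a : V) : `|a| <= 2 * d -> `|dotv a z| <= 2 * d * `|z ord0 i| + 2 * d * S.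
  move=> a2d; rewrite (dotv_lift i) (le_trans (ler_normD _ _))// lerD//.
    by rewrite normrM ler_wpM2r// (le_trans (normv_coord _ _)).
  rewrite mulr_sumr (le_trans (ler_norm_sum _ _ _))// ler_sum// => j _.
  by rewrite normrM ler_wpM2r// (le_trans (normv_coord _ _)).
(* Monotonicity is applied to the crossed pairs: [q] at [x] with [p'] at [y] bounds [dotv w z] from
   above, [p] at [x] with [q'] at [y] bounds it from below. *)
have wz : `|dotv w z| <= 2 * d * `|z ord0 i| + 2 * d * S.
  have h1 : `|(p' - p0) - (q - q0)| <= 2 * d.
    by rewrite (le_trans (ler_normB _ _))// mulr_natl mulr2n lerD.
  have h2 : `|(q' - q0) - (p - p0)| <= 2 * d.
    by rewrite (le_trans (ler_normB _ _))// mulr_natl mulr2n lerD.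
  have := small _ h1; have := small _ h2.
  have := maximizes_monotone qx p'y; have := maximizes_monotone px q'y.
  rewrite -/z !ler_norml /w !dotvBl; lra.
have wS : `|\sum_(j < m) w ord0 (lift i j) * z ord0 (lift i j)| <= `|w| * S.
  rewrite mulr_sumr (le_trans (ler_norm_sum _ _ _))// ler_sum// => j _.
  by rewrite normrM ler_wpM2r// normv_coord.
have key : d * `|z ord0 i| <= (`|w| + 2 * d) * S.
  have : w ord0 i * `|z ord0 i| <= `|dotv w z| + `|w| * S.
    rewrite -[X in X * _ <= _]ger0_norm; last by apply: le_trans wi; rewrite mulr_ge0// ltW.
    rewrite -normrM (dotv_lift i); apply: le_trans (lerD (lexx _) wS).
    by rewrite -{1}(addrK (\sum_(j < m) w ord0 (lift i j) * z ord0 (lift i j)) (w ord0 i * _)) ler_normB.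
  have : 3 * d * `|z ord0 i| <= w ord0 i * `|z ord0 i| by rewrite ler_wpM2r.
  lra.
have -> : y ord0 i - x ord0 i = z ord0 i by rewrite !mxE.
have -> : \sum_(j < m) `|y ord0 (lift i j) - x ord0 (lift i j)| = S.
  by apply: eq_bigr => j _; rewrite !mxE.
by rewrite /L mulrAC ler_pdivlMr// mulrC.
Qed.

Lemma rat_approx (x : V) (d : R) : 0 < d -> exists p : 'rV[rat]_m.+1, `|x - map_mx ratr p| <= d.
Proof.
move=> d0.
have h i : exists r : rat, `|x ord0 i - ratr r| <= d.
  have /(@rat_in_itvoo R)[r] : x ord0 i - d < x ord0 i by lra.
  by rewrite in_itv/= => hr; exists r; rewrite ler_norml; lra.
have [f fP] := choice h.
exists (\row_i f i); apply: normv_le => [|i]; first exact: ltW.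
by rewrite !mxE.
Qed.

(** Two distinct maximizers differ in some coordinate; rational centres and a width [l.+1%:R^-1] at
    most a fifth of that gap place the point in one of countably many pieces. *)
Lemma box_covers_double_max e : 0 < e ->
  box_covers [set x : V | (forall j, `|x ord0 j| <= 1) /\
     exists p q, [/\ maximizes x p, maximizes x q & p != q]] e.
Proof.
pose idx := ('I_m.+1 * nat * 'rV[rat]_m.+1 * 'rV[rat]_m.+1)%type.
pose F (k : nat) : set V := if (unpickle k : option idx) is Some (i, l, p0, q0)
  then double_max_piece i l.+1%:R^-1 (map_mx ratr p0) (map_mx ratr q0) else set0.
have F0 k e' : 0 < e' -> box_covers (F k) e'.
  rewrite /F; case: unpickle => [[[[i l] p0] q0]|] e0.
    by apply: box_covers_double_max_piece => //; rewrite invr_gt0.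
  apply: (@box_coversS _ _ _ (double_max_piece ord0 1 0 0)) => //.
  exact: box_covers_double_max_piece.
move=> e0; apply: box_coversS (box_covers_bigcup F0 e0).
move=> x [x1 [p [q [px qx pq]]]].
have [i pqi] : exists i, p ord0 i != q ord0 i.
  apply/existsP; rewrite -negb_forall; apply: contra pq => /forallP h.
  by apply/eqP/rowP => i; exact/eqP.
wlog {pqi} pqi : p q px qx {pq} / p ord0 i < q ord0 i.
  move=> h; move: pqi; rewrite neq_lt => /orP[pqi|pqi].
    by apply: (h p q) => //; apply: contraTneq pqi => ->; rewrite ltxx.
  by apply: (h q p) => //; apply: contraTneq pqi => ->; rewrite ltxx.
pose l := Num.truncn (5 / (q ord0 i - p ord0 i)).
have l0 : 0 < l.+1%:R^-1 :> R by rewrite invr_gt0.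
have [p0 pp0] := rat_approx p l0.
have [q0 qq0] := rat_approx q l0.
exists (pickle ((i, l, p0, q0) : idx)) => //; rewrite /F pickleK.
split=> //; exists p, q; split => //.
rewrite ler_pdivrMr// mulrC -ler_pdivrMr ?subr_gt0//.
by apply/ltW; rewrite /l truncnS_gt.
Qed.

End MaximizerNotUnique.

(** * Gauges, Wulff shapes and support functions *)

Section Gauge.
Context {R : realType} {m : nat}.
Notation V := 'rV[R]_m.+1.
Implicit Types (f h : V -> R) (x y u v xi : V).

Definition pos_cont f := {within sphere, continuous f} /\ forall u, sphere u -> 0 < f u.

(** For every positive continuous [f], on the sphere this is the Minkowski functional of [wulff f],
    as [wulff_gauge] shows. *)
Definition gauge f x := sup [set dotv u x / f u | u in sphere].

Lemma within_sphere_continuousP f : {within sphere, continuous f} <->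
  forall x, sphere x -> f @ within sphere (nbhs x) --> f x.
Proof. exact: subspace_continuousP. Qed.

Lemma ratio_continuous f x : pos_cont f ->
  {within sphere, continuous (fun u => dotv u x / f u)}.
Proof.
move=> [/within_sphere_continuousP fc f0]; apply/within_sphere_continuousP => u su.
apply: cvgM; last by apply: cvgV; [rewrite gt_eqF// f0|exact: fc].
by apply: cvg_dotv; [apply: cvg_within|exact: cvg_cst].
Qed.

Lemma gauge_attained f x : pos_cont f ->
  exists2 u, sphere u & forall v, sphere v -> dotv v x / f v <= dotv u x / f u.
Proof.
move=> pf; have [u + umax] := compact_EVT_max sphere_nonempty compact_sphere (@ratio_continuous _ x pf).
by rewrite inE => su; exists u => // v sv; apply: umax; rewrite inE.
Qed.

Lemma gaugeP f x : pos_cont f -> exists2 u, sphere u & gauge f x = dotv u x / f u.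
Proof.
move=> /gauge_attained-/(_ x)[u su umax]; exists u => //.
apply/eqP; rewrite eq_le; apply/andP; split.
  apply: ge_sup; first by exists (dotv u x / f u), u.
  by move=> _ [v sv <-]; exact: umax.
apply: ub_le_sup; last by exists u.
by exists (dotv u x / f u) => _ [v sv <-]; exact: umax.
Qed.

Lemma gauge_ge f x u : pos_cont f -> sphere u -> dotv u x / f u <= gauge f x.
Proof.
move=> pf su; have [u0 su0 umax] := gauge_attained x pf.
apply: ub_le_sup; last by exists u.
by exists (dotv u0 x / f u0) => _ [v sv <-]; exact: umax.
Qed.

Lemma gauge_le f x c : pos_cont f ->
  (forall u, sphere u -> dotv u x / f u <= c) -> gauge f x <= c.
Proof. by move=> pf h; have [u su ->] := gaugeP x pf; exact: h. Qed.

Lemma gauge_gt0 f x : pos_cont f -> sphere x -> 0 < gauge f x.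
Proof.
move=> pf sx; apply: lt_le_trans (gauge_ge x pf sx).
by rewrite sx divr_gt0//; exact: pf.2.
Qed.

Definition wulff f : set V := [set x | forall u, sphere u -> dotv x u <= f u].

Lemma wulff_gauge f t x : pos_cont f -> 0 <= t -> wulff f (t *: x) <-> t * gauge f x <= 1.
Proof.
move=> pf t0; split => [h|h u su].
  have [u su ->] := gaugeP x pf.
  rewrite mulrA ler_pdivrMr ?mul1r; last exact: pf.2.
  by rewrite dotvC -dotvZl; exact: h.
rewrite dotvZl -[leRHS]mul1r -ler_pdivrMr; last exact: pf.2.
by apply: le_trans h; rewrite -mulrA ler_wpM2l// dotvC gauge_ge.
Qed.

Lemma gauge_eq f h x : pos_cont f -> pos_cont h -> sphere x ->
  (forall t, 0 <= t -> wulff f (t *: x) <-> wulff h (t *: x)) -> gauge f x = gauge h x.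
Proof.
move=> pf ph sx fh.
wlog suff : f h pf ph fh / gauge f x <= gauge h x.
  move=> W; apply/eqP; rewrite eq_le !W// => t t0; exact: iff_sym (fh _ t0).
have h0 := gauge_gt0 ph sx.
have t0 : 0 <= (gauge h x)^-1 by rewrite invr_ge0 ltW.
have /(wulff_gauge x pf t0) : wulff f ((gauge h x)^-1 *: x).
  by apply/fh => //; apply/(wulff_gauge x ph t0); rewrite mulVf ?gt_eqF.
by rewrite mulrC ler_pdivrMr// mul1r.
Qed.

Lemma pos_cont_bounds f : pos_cont f ->
  exists r M, [/\ 0 < r, 0 < M & forall u, sphere u -> r <= f u <= M].
Proof.
move=> [fc f0].
have [u + umax] := compact_EVT_max sphere_nonempty compact_sphere fc.
have [v + vmin] := compact_EVT_min sphere_nonempty compact_sphere fc.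
rewrite !inE => sv su; exists (f v), (f u); split; rewrite ?f0// => w sw.
by rewrite vmin ?umax// inE.
Qed.

Lemma gauge_bounds f r M x : pos_cont f -> 0 < r -> 0 < M ->
  (forall u, sphere u -> r <= f u <= M) -> sphere x -> M^-1 <= gauge f x <= r^-1.
Proof.
move=> pf r0 M0 rfM sx; apply/andP; split.
  apply: le_trans (gauge_ge x pf sx); rewrite sx mul1r lef_pV2 ?posrE ?pf.2//.
  by case/andP: (rfM _ sx).
apply: gauge_le => // u su; rewrite ler_pdivrMr ?pf.2//.
apply: (le_trans (dotv_sphere_le1 su sx)); rewrite mulrC ler_pdivlMr// mul1r.
by case/andP: (rfM _ su).
Qed.

Lemma gauge_sub f r x y : pos_cont f -> 0 < r -> (forall u, sphere u -> r <= f u) ->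
  gauge f x - gauge f y <= m.+1%:R / r * `|x - y|.
Proof.
move=> pf r0 rf; have [u su ->] := gaugeP x pf.
apply: (@le_trans _ _ (dotv u x / f u - dotv u y / f u)); first by rewrite lerB// gauge_ge.
rewrite -mulrBl -dotvBr ler_pdivrMr ?pf.2//.
apply: (le_trans (ler_norm _)); apply: (le_trans (dotv_norm _ _)).
have h1 := sphere_norm su; have h2 := rf _ su.
have -> : m.+1%:R / r * `|x - y| * f u = m.+1%:R * (f u / r) * `|x - y| by ring.
apply: ler_wpM2r => //; apply: ler_wpM2l => //.
by apply: (le_trans h1); rewrite ler_pdivlMr// mul1r.
Qed.

Lemma lipschitz_continuous f (L : R) : (forall x y, f x - f y <= L * `|x - y|) -> continuous f.
Proof.
move=> fL x; apply/(@cvgrPdist_le _ _ _ (nbhs x) _ f (f x)) => e e0.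
have L0 : 0 < `|L| + 1 by rewrite ltr_wpDl.
near=> y.
have xy : `|x - y| <= e / (`|L| + 1).
  near: y; apply/nbhs_ballP; exists (e / (`|L| + 1)); first by rewrite /= divr_gt0.
  by move=> y; rewrite -ball_normE => /ltW.
have : L * `|x - y| <= e.
  apply: (@le_trans _ _ ((`|L| + 1) * `|x - y|)).
    by rewrite ler_wpM2r// (le_trans (ler_norm _))// lerDl.
  by rewrite mulrC -ler_pdivlMr.
have := fL x y; have := fL y x; rewrite (distrC y x) ler_norml; lra.
Unshelve. all: by end_near. Qed.

Lemma gauge_continuous f : pos_cont f -> continuous (gauge f).
Proof.
move=> pf; have [r [M [r0 _ rfM]]] := pos_cont_bounds pf.
apply: (@lipschitz_continuous _ (m.+1%:R / r)) => x y.
by apply: gauge_sub => // u /rfM/andP[].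
Qed.

Lemma wulff_body f : pos_cont f -> convex_body_o (wulff f).
Proof.
move=> pf; have [r [M [r0 M0 rfM]]] := pos_cont_bounds pf.
split; [|split].
- apply: bounded_closed_compact.
    exists M; split; first exact: num_real.
    move=> M' MM' x xf /=; apply: (le_trans _ (ltW MM')).
    apply: normv_le => [|i]; first exact: ltW.
    rewrite ler_norml -(dotv_delta x i) lerNl -dotvNr; apply/andP; split.
      apply: (le_trans (xf _ (sphereN (sphere_delta i)))).
      by case/andP: (rfM _ (sphereN (sphere_delta i))).
    apply: (le_trans (xf _ (sphere_delta i))).
    by case/andP: (rfM _ (sphere_delta i)).
  rewrite (_ : wulff f = \bigcap_(u in sphere) ((fun x : V => dotv x u) @^-1` [set t | t <= f u])); last first.
    by apply/seteqP; split => x h u su; exact: h.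
  apply: closed_bigI => u su; apply: closed_comp; last exact: closed_le.
  by move=> x _; exact: dotvl_continuous.
- move=> x y t xf yf /andP[t0 t1] u su; rewrite dotvDl !dotvZl.
  have := xf _ su; have := yf _ su => h1 h2.
  have -> : f u = (1 - t) * f u + t * f u by ring.
  by rewrite lerD// ler_wpM2l// subr_ge0.
- apply/nbhs_ballP; exists (r / m.+1%:R); first by rewrite /= divr_gt0.
  move=> x; rewrite -ball_normE/= sub0r normrN => xr u su.
  apply: (le_trans (ler_norm _)); apply: (le_trans (dotv_norm _ _)).
  apply: (@le_trans _ _ (m.+1%:R * `|x| * 1)).
    by rewrite ler_wpM2l ?mulr_ge0// sphere_norm.
  rewrite mulr1 mulrC -ler_pdivlMr//; apply: (le_trans (ltW xr)).
  by rewrite ler_wpM2r ?invr_ge0//; case/andP: (rfM _ su).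
Qed.

Lemma wulff_body_e f : pos_cont f -> (forall u, sphere u -> f (- u) = f u) ->
  convex_body_e (wulff f).
Proof.
move=> pf fe; split; first exact: wulff_body.
move=> x xf u su; rewrite dotvNl -dotvNr -fe//; apply: xf; exact: sphereN.
Qed.

End Gauge.

(** * Convex bodies: support functions, separation and normals *)

Section ConvexBodies.
Context {R : realType} {m : nat}.
Notation V := 'rV[R]_m.+1.
Implicit Types (K : set V) (f : V -> R) (x y u v xi : V).

Lemma support_attained K x : K !=set0 -> compact K ->
  exists2 y, K y & forall z, K z -> dotv x z <= dotv x y.
Proof.
move=> K0 cK; have [y + ymax] := compact_EVT_max K0 cK (continuous_subspaceT (@dotvr_continuous R m.+1 x)).
by rewrite inE => Ky; exists y => // z Kz; apply: ymax; rewrite inE.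
Qed.

Lemma body_o0 K : convex_body_o K -> K 0.
Proof. by move=> [_ [_ /nbhs_singleton]]. Qed.

Lemma support_realized K x : convex_body_o K -> exists2 y, K y & support_fun K x = dotv x y.
Proof.
move=> bK; have [|y Ky ymax] := @support_attained K x _ bK.1; first by exists 0; exact: body_o0.
exists y => //; apply/eqP; rewrite eq_le; apply/andP; split.
  apply: ge_sup; first by exists (dotv x y), y.
  by move=> _ [z Kz <-]; exact: ymax.
apply: ub_le_sup; last by exists y.
by exists (dotv x y) => _ [z Kz <-]; exact: ymax.
Qed.

Lemma support_ge K x y : convex_body_o K -> K y -> dotv x y <= support_fun K x.
Proof.
move=> bK Ky; have [|z Kz zmax] := @support_attained K x _ bK.1; first by exists y.
by apply: ub_le_sup; [exists (dotv x z) => _ [w Kw <-]; exact: zmax|exists y].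
Qed.

Lemma support_continuous K : convex_body_o K -> continuous (support_fun K).
Proof.
move=> bK; have [M [_ KM]] := compact_bounded bK.1.
have {}KM z : K z -> `|z| <= M + 1 by apply: KM; rewrite ltrDl.
apply: (@lipschitz_continuous _ _ _ (m.+1%:R * (M + 1))) => x y.
have [z Kz ->] := support_realized x bK.
apply: (@le_trans _ _ (dotv x z - dotv y z)); first by rewrite lerB// support_ge.
rewrite -dotvBl (le_trans (ler_norm _))// (le_trans (dotv_norm _ _))//.
by rewrite -mulrA -[leRHS]mulrA ler_wpM2l// mulrC ler_wpM2r// KM.
Qed.

Lemma support_gt0 K u : convex_body_o K -> sphere u -> 0 < support_fun K u.
Proof.
move=> bK su; have [_ [_ /nbhs_ballP[e /= e0 eK]]] := bK.
have Ku : K ((e / 2) *: u).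
  apply: eK; rewrite -ball_normE/= sub0r normrN normrZ ger0_norm; last by rewrite divr_ge0// ltW.
  apply: (@le_lt_trans _ _ (e / 2)); last by lra.
  by rewrite -[leRHS]mulr1 ler_wpM2l ?sphere_norm// divr_ge0// ltW.
apply: lt_le_trans (support_ge u bK Ku); rewrite dotvZr su; lra.
Qed.

Lemma support_pos_cont K : convex_body_o K -> pos_cont (support_fun K).
Proof.
move=> bK; split; last by move=> u; exact: support_gt0.
exact: continuous_subspaceT (support_continuous bK).
Qed.

(** The separating direction points from the nearest point [y] of [K] to [x]; minimality of the
    distance makes the angle at [y] with every point of [K] obtuse or right. *)
Lemma separation K x : K !=set0 -> compact K -> convex_set_Rn K -> ~ K x ->
  exists2 u, sphere u & forall z, K z -> dotv z u < dotv x u.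
Proof.
move=> K0 cK convK Kx.
have dc : {within K, continuous (fun y : V => dotv (x - y) (x - y))}.
  apply: continuous_subspaceT => y.
  have h : (x - z) @[z --> y] --> x - y by apply: (@cvgB _ _ _ (nbhs y)); [exact: cvg_cst|exact: cvg_id].
  exact: (@cvg_dotv _ _ _ (nbhs y)).
have [y + ymin] := compact_EVT_min K0 cK dc; rewrite inE => Ky.
have xy : x - y != 0 by rewrite subr_eq0; apply: contra_notN Kx => /eqP ->.
have obtuse z : K z -> dotv (x - y) (z - y) <= 0.
  move=> Kz; rewrite leNgt; apply/negP => a0.
  set a := dotv (x - y) (z - y) in a0.
  pose b := dotv (z - y) (z - y).
  have b0 : 0 <= b by exact: dotvv_ge0.
  have ab : 0 < a + b by lra.
  (* Moving from [y] towards [z] by [t] lowers the squared distance by [t * (2 * a - t * b)]; this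
     [t] is at most 1 and has [t * b <= a], so the decrease is strict. *)
  pose t := a / (a + b).
  have t0 : 0 < t by rewrite divr_gt0.
  have t1 : t <= 1 by rewrite ler_pdivrMr// mul1r; lra.
  have : K ((1 - t) *: y + t *: z) by apply: convK => //; rewrite ltW.
  move=> /mem_set /ymin.
  have -> : x - ((1 - t) *: y + t *: z) = (x - y) - t *: (z - y).
    by apply/rowP => i; rewrite !mxE; ring.
  have expand (A B : V) : dotv (A - t *: B) (A - t *: B) = dotv A A - t * (2 * dotv A B - t * dotv B B).
    by rewrite dotvBl !dotvBr !dotvZl !dotvZr (dotvC B A); ring.
  rewrite expand -/a -/b => h.
  have {h} : 2 * a <= t * b.
    have : t * (2 * a - t * b) <= 0 by lra.
    by rewrite pmulr_rle0// subr_le0.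
  have : t * b <= a by rewrite /t mulrAC ler_pdivrMr// ler_wpM2l//; lra.
  lra.
exists (unitv (x - y)) => [|z Kz]; first exact: sphere_unitv.
rewrite /unitv !dotvZr ltr_pM2l; last by rewrite invr_gt0 sqrtr_gt0 dotvv_gt0.
have h1 := obtuse _ Kz; have h2 := dotvv_gt0 xy.
have E : dotv (x - y) (x - y) = dotv (x - y) x - dotv (x - y) y by exact: dotvBr.
by move: h1 h2; rewrite E dotvBr (dotvC z) (dotvC x (x - y)); lra.
Qed.

Lemma body_wulff K : convex_body_o K -> wulff (support_fun K) = K.
Proof.
move=> bK; apply/seteqP; split => [x hx|x Kx u su]; last by rewrite dotvC support_ge.
apply: contrapT => Kx.
have [|u su uK] := @separation K x _ bK.1 bK.2.1 Kx; first by exists 0; exact: body_o0.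
have [z Kz hz] := support_realized u bK.
by have := hx _ su; rewrite hz leNgt dotvC uK.
Qed.

Lemma support_wulff_le f u : pos_cont f -> sphere u -> support_fun (wulff f) u <= f u.
Proof.
by move=> pf su; have [y yf ->] := support_realized u (wulff_body pf); rewrite dotvC; exact: yf.
Qed.

(** [f] and the support function of [wulff f] have the same Wulff shape, and the gauge depends only
    on that shape. A perturbed function can thus be compared with a body without computing its
    convexification. *)
Lemma gauge_support_wulff f xi : pos_cont f -> sphere xi ->
  gauge (support_fun (wulff f)) xi = gauge f xi.
Proof.
move=> pf sxi; have bK := wulff_body pf.
by apply: gauge_eq => //; [exact: support_pos_cont|rewrite body_wulff].
Qed.

Lemma radial_gauge K xi : convex_body_o K -> sphere xi ->
  radial_fun K xi = (gauge (support_fun K) xi)^-1.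
Proof.
move=> bK sxi; have pK := support_pos_cont bK; have g0 := gauge_gt0 pK sxi.
have mem t : 0 <= t -> K (t *: xi) <-> t <= (gauge (support_fun K) xi)^-1.
  by move=> t0; rewrite -{1}(body_wulff bK) wulff_gauge// -ler_pdivlMr// mul1r.
have gin : K ((gauge (support_fun K) xi)^-1 *: xi) by apply/mem => //; rewrite invr_ge0 ltW.
apply/eqP; rewrite eq_le; apply/andP; split.
  apply: ge_sup; first by exists (gauge (support_fun K) xi)^-1; split=> //; rewrite invr_ge0 ltW.
  by move=> t [t0 /mem]; exact.
apply: ub_le_sup; last by split=> //; rewrite invr_ge0 ltW.
by exists (gauge (support_fun K) xi)^-1 => t [t0 /mem]; exact.
Qed.

(** Being normal becomes an equality between continuous functions of the pair [(xi, u)], hence a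
    closed condition; it also says that [u] attains the supremum in the gauge. *)
Lemma normalsP K xi u : convex_body_o K -> sphere xi ->
  normals K xi u <-> sphere u /\ dotv u xi = gauge (support_fun K) xi * support_fun K u.
Proof.
move=> bK sxi; have pK := support_pos_cont bK; have g0 := gauge_gt0 pK sxi.
rewrite /normals/= radial_gauge//; split=> -[su h]; split=> //.
  apply/eqP; rewrite eq_le; apply/andP; split.
    by rewrite -ler_pdivrMr ?gauge_ge// pK.2.
  have [y Ky ->] := support_realized u bK.
  by have := h _ Ky; rewrite dotvZl (dotvC xi) (dotvC y) ler_pdivlMl.
move=> y Ky; rewrite dotvZl (dotvC xi) h mulrA mulVf ?gt_eqF// mul1r dotvC.
exact: support_ge.
Qed.

Lemma normals_exist K xi : convex_body_o K -> sphere xi -> exists u, normals K xi u.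
Proof.
move=> bK sxi; have pK := support_pos_cont bK.
have [u su gu] := gaugeP xi pK; exists u; apply/normalsP => //; split=> //.
by rewrite gu divfK// gt_eqF// pK.2.
Qed.

Lemma support_even K u : convex_body_e K -> support_fun K (- u) = support_fun K u.
Proof.
move=> [bK eK]; wlog suff : u / support_fun K (- u) <= support_fun K u.
  by move=> h; apply/eqP; rewrite eq_le h/= -{1}(opprK u) h.
have [y Ky ->] := support_realized (- u) bK.
by rewrite dotvNl -dotvNr support_ge//; exact: eK.
Qed.

Lemma gauge_even f xi : pos_cont f -> (forall u, sphere u -> f (- u) = f u) ->
  gauge f (- xi) = gauge f xi.
Proof.
move=> pf fe; wlog suff : xi / gauge f (- xi) <= gauge f xi.
  by move=> h; apply/eqP; rewrite eq_le h/= -{1}(opprK xi) h.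
apply: gauge_le => // u su; rewrite dotvNr -dotvNl -fe//; apply: gauge_ge => //.
exact: sphereN.
Qed.

Lemma normals_even K xi u : convex_body_e K -> sphere xi ->
  normals K xi u -> normals K (- xi) (- u).
Proof.
move=> eK sxi /(normalsP _ eK.1 sxi)[su h].
apply/(normalsP _ eK.1 (sphereN sxi)); split; first exact: sphereN.
rewrite gauge_even ?support_even//; first by rewrite dotvNl dotvNr opprK.
  by apply: support_pos_cont; exact: eK.1.
by move=> v _; rewrite support_even.
Qed.

(** In the contact equality the gauge is at least [M^-1] and the support function at least [r], so a
    normal stays uniformly away from orthogonality to its direction. *)
Lemma normal_dot_ge K xi u : convex_body_o K -> sphere xi -> normals K xi u ->
  forall r M, 0 < r -> (forall v, sphere v -> r <= support_fun K v <= M) -> r / M <= dotv u xi.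
Proof.
move=> bK sxi /(normalsP _ bK sxi)[su ->] r M r0 rM.
have pK := support_pos_cont bK.
have M0 : 0 < M by have /andP[h1 h2] := rM _ sxi; exact: lt_le_trans (le_trans h1 h2).
have /andP[h1 _] := gauge_bounds pK r0 M0 rM sxi.
have /andP[h2 _] := rM _ su.
by rewrite mulrC ler_pM// ?invr_ge0 ltW.
Qed.

End ConvexBodies.

(** * Measurability of the Gauss image map *)

Section BorelMeasurability.
Context {R : realType} {m : nat}.
Notation V := 'rV[R]_m.+1.
Notation T := (borelRn R m.+1).
Implicit Types (K : set V) (f : V -> R) (x y u v xi : V).

Lemma open_borel (U : set V) : open U -> measurable (U : set T).
Proof. by move=> oU; apply: sub_sigma_algebra. Qed.

Lemma closed_borel (C : set V) : closed C -> measurable (C : set T).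
Proof.
by move=> cC; rewrite -(setCK C); apply: measurableC; apply: open_borel; exact: closed_openC.
Qed.

Lemma measurable_sphere : measurable (sphere : set T).
Proof. by apply: closed_borel; exact: closed_sphere. Qed.

Lemma measurable_great_subsphere v : measurable (great_subsphere v : set T).
Proof.
apply: closed_borel; rewrite (_ : great_subsphere v = sphere `&` (dotv v) @^-1` [set 0])//.
apply: closedI; first exact: closed_sphere.
apply: closed_comp; last exact: closed_eq.
by move=> x _; exact: dotvr_continuous.
Qed.

Lemma measurable_within_sphere f : {within sphere, continuous f} ->
  measurable_fun (sphere : set T) (f : T -> R).
Proof.
move=> /continuousP fc; apply: (measurability _ (RGenOpens.measurableE R)) => //.
move=> _ [U oU <-].
have oU' : open U.
  by move: oU => [a [b ->]]; exact: interval_open.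
have /open_subspaceP[W oW WE] := fc _ oU'.
rewrite (_ : _ `&` _ = W `&` sphere); first by apply: measurableI; [exact: open_borel|exact: measurable_sphere].
by rewrite WE setIC.
Qed.

Let cfst : continuous (@fst V (V * V)). Proof. by move=> p; exact: cvg_fst. Qed.

Lemma closed_projection (G : set (V * (V * V))) : closed G ->
  G `<=` sphere `*` (sphere `*` sphere) -> closed (fst @` G).
Proof.
move=> cG Gs; apply: compact_closed; first exact: norm_hausdorff.
apply: continuous_compact; first exact: continuous_subspaceT cfst.
apply: (subclosed_compact cG _ Gs); apply: compact_setX; first exact: compact_sphere.
by apply: compact_setX; exact: compact_sphere.
Qed.

Let cfs : continuous (fun p : V * (V * V) => p.2.1).
Proof.
move=> p; apply: (@continuous_comp _ _ _ (@snd V (V * V)) fst p) => ?.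
  exact: cvg_snd.
exact: cvg_fst.
Qed.

Let css : continuous (fun p : V * (V * V) => p.2.2).
Proof.
move=> p; apply: (@continuous_comp _ _ _ (@snd V (V * V)) snd p) => ?.
  exact: cvg_snd.
exact: cvg_snd.
Qed.

(** Two normals are recorded at once so that a single compact set projects onto [alpha_star]
    (through its diagonal) and onto the pieces of [multi_normal]. *)
Definition contact_pairs K : set (V * (V * V)) := [set p | sphere p.1 /\ normals K p.1 p.2.1 /\ normals K p.1 p.2.2].

Lemma closed_contact_pairs K : convex_body_o K -> closed (contact_pairs K).
Proof.
move=> bK; have pK := support_pos_cont bK.
pose C (g : V * (V * V) -> V) := [set p | sphere p.1 /\ sphere (g p) /\
   dotv (g p) p.1 - gauge (support_fun K) p.1 * support_fun K (g p) = 0].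
have CE : contact_pairs K = C (fun p => p.2.1) `&` C (fun p => p.2.2).
  apply/seteqP; split=> -[xi [u v]] /=.
    move=> [s1 [/(normalsP _ bK s1)[? h1] /(normalsP _ bK s1)[? h2]]].
    by split; split=> //; split=> //=; rewrite ?h1 ?h2 subrr.
  move=> [[s1 [? /subr0_eq h1]] [_ [? /subr0_eq h2]]].
  by split=> //; split; apply/normalsP.
have cC g : continuous g -> closed (C g).
  move=> cg; rewrite (_ : C g = fst @^-1` sphere `&` (g @^-1` sphere `&`
    (fun p => dotv (g p) p.1 - gauge (support_fun K) p.1 * support_fun K (g p)) @^-1` [set 0]))//.
  apply: closedI.
    by apply: closed_comp; [move=> p _; exact: cfst|exact: closed_sphere].
  apply: closedI.
    by apply: closed_comp; [move=> p _; exact: cg|exact: closed_sphere].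
  apply: closed_comp; last exact: closed_eq.
  move=> p _; apply: (@cvgB _ _ _ (nbhs p)).
    by apply: (@cvg_dotv _ _ _ (nbhs p)); [exact: cg|exact: cfst].
  apply: (@cvgM _ _ (nbhs p)).
    by apply: (@continuous_comp _ _ _ fst (gauge (support_fun K)) p); [exact: cfst|exact: gauge_continuous].
  by apply: (@continuous_comp _ _ _ g (support_fun K) p); [exact: cg|exact: support_continuous].
rewrite CE; apply: closedI; apply: cC; [exact: cfs|exact: css].
Qed.

Lemma closed_alpha_star K (C : set V) : convex_body_o K -> closed C -> closed (alpha_star K C).
Proof.
move=> bK cC.
rewrite (_ : alpha_star K C = fst @` (contact_pairs K `&` (fun p => p.2.1) @^-1` C)).
  apply: closed_projection.
    apply: closedI; first exact: closed_contact_pairs.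
    by apply: closed_comp => // p _; exact: cfs.
  by move=> [xi [u v]] [[/= ? [[? _] [? _]]] _].
apply/seteqP; split=> [xi [sxi [u [nu Cu]]]|_ [[xi [u v]] [[/= ? [? ?]] ?] <-]].
  by exists (xi, (u, u)).
by split=> //; exists u.
Qed.

Definition multi_normal K : set V := [set xi | sphere xi /\
  exists u v, [/\ normals K xi u, normals K xi v & u != v]].

(** Distinct normals are at distance at least [k.+1%:R^-1] for some [k]; each such condition is
    closed and projects to a compact set. *)
Lemma measurable_multi_normal K : convex_body_o K -> measurable (multi_normal K : set T).
Proof.
move=> bK.
pose F (k : nat) : set V := fst @` (contact_pairs K `&`
  (fun p => `|p.2.1 - p.2.2|) @^-1` [set t | k.+1%:R^-1 <= t]).
rewrite (_ : multi_normal K = \bigcup_k F k).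
  apply: (@bigcup_measurable _ T) => k _; apply: closed_borel; apply: closed_projection.
    apply: closedI; first exact: closed_contact_pairs.
    apply: closed_comp; last exact: closed_ge.
    move=> p _; apply: (@cvg_norm _ _ _ (nbhs p)).
    by apply: (@cvgB _ _ _ (nbhs p)); [exact: cfs|exact: css].
  by move=> [xi [u v]] [[/= ? [[? _] [? _]]] _].
apply/seteqP; split=> [xi [sxi [u [v [nu nv uv]]]]|? [k _ [[xi [u v]] [[/= sxi [nu nv]] h] <-]]].
  have d0 : 0 < `|u - v| by rewrite normr_gt0 subr_eq0.
  exists (Num.truncn `|u - v|^-1) => //; exists (xi, (u, v)) => //; split => //=.
  by rewrite invf_ple ?posrE// ltW// truncnS_gt.
split=> //; exists u, v; split=> //; rewrite -subr_eq0 -normr_gt0; apply: lt_le_trans h.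
by rewrite invr_gt0.
Qed.

(** The normals [u] at [xi] correspond to the maximizers [u / h u] of the linear functional [xi].
    Since maximizers are unchanged by positive scaling, the whole cone consists of points of double
    maximum. *)
Lemma sph_lebesgue_multi_normal K : convex_body_o K -> sph_lebesgue (multi_normal K) = 0%E.
Proof.
move=> bK; have pK := support_pos_cont bK; rewrite /sph_lebesgue lebesgue_outer_eq0 ?mule0// => e e0.
pose P : set V := [set (support_fun K u)^-1 *: u | u in sphere].
apply: box_coversS (box_covers_double_max P e0).
move=> x [t [xi [/andP[t0 t1] [[sxi [u [v [/(normalsP _ bK sxi)[su hu] /(normalsP _ bK sxi)[sv hv] uv]]]] [_ ->]]]]].
have P_max w : sphere w -> dotv w xi = gauge (support_fun K) xi * support_fun K w ->
    maximizes P (t *: xi) ((support_fun K w)^-1 *: w).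
  move=> sw hw; split; first by exists w.
  move=> _ [z sz <-]; rewrite !dotvZl !dotvZr !(mulrCA _ t) ler_pM2l// hw.
  rewrite [leRHS]mulrCA mulVf ?mulr1 ?gt_eqF ?pK.2// mulrC.
  exact: gauge_ge.
split=> [j|].
  rewrite mxE normrM (gtr0_norm t0) -[leRHS]mulr1 ler_pM// ?(ltW t0)//.
  exact: sphere_coord.
exists ((support_fun K u)^-1 *: u), ((support_fun K v)^-1 *: v).
split; [exact: P_max|exact: P_max|].
apply: contra uv => /eqP E.
have hu0 : 0 < support_fun K u by exact: pK.2.
have hv0 : 0 < support_fun K v by exact: pK.2.
(* Distinct normals give distinct maximizers: otherwise they would be positive multiples of each
   other on the sphere. *)
have uE : u = (support_fun K u / support_fun K v) *: v.
  by rewrite -scalerA -E scalerA mulfV ?gt_eqF// scale1r.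
set c := _ / _ in uE; have c0 : 0 < c by rewrite divr_gt0.
have : c ^+ 2 = 1.
  by move: (su); rewrite /sphere/= uE dotvZl dotvZr sv mulr1.
move=> /eqP; rewrite sqrf_eq1 => /orP[/eqP c1|/eqP c1]; last by move: c0; rewrite c1; lra.
by rewrite uE c1 scale1r.
Qed.

Definition regular_dir K : set V := sphere `\` multi_normal K.

Lemma measurable_regular_dir K : convex_body_o K -> measurable (regular_dir K : set T).
Proof. by move=> bK; apply: (@measurableD _ T); [exact: measurable_sphere|exact: measurable_multi_normal]. Qed.

Lemma alphaP K xi : convex_body_o K -> sphere xi -> normals K xi (alpha K xi).
Proof. by move=> bK sxi; apply: xgetPex; exact: normals_exist. Qed.

Lemma alpha_unique K xi u : convex_body_o K -> regular_dir K xi -> normals K xi u -> u = alpha K xi.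
Proof.
move=> bK [sxi nm] nu; apply: contrapT => ua; apply: nm; split=> //.
by exists u, (alpha K xi); split=> //; [exact: alphaP|exact/eqP].
Qed.

Lemma alpha_starE K xi w : convex_body_o K -> regular_dir K xi ->
  alpha_star K w xi <-> w (alpha K xi).
Proof.
move=> bK rxi; split=> [[_ [u [nu wu]]]|wa]; first by rewrite -(alpha_unique bK rxi nu).
by split; [exact: rxi.1|exists (alpha K xi); split=> //; apply: alphaP => //; exact: rxi.1].
Qed.

(** On regular directions the preimage of an open set is the complement of [alpha_star] of a closed
    set, which is closed. *)
Lemma measurable_alpha K : convex_body_o K ->
  measurable_fun (regular_dir K : set T) (alpha K : T -> T).
Proof.
move=> bK; apply: (@measurability _ _ T T _ _ (@open V : set (set T)) erefl).
move=> _ [U oU <-].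
rewrite (_ : _ `&` _ = regular_dir K `\` alpha_star K (~` U)).
  apply: measurableD; first exact: measurable_regular_dir.
  apply: closed_borel; apply: closed_alpha_star => //; exact: open_closedC.
apply/seteqP; split=> xi [rxi h]; split=> //.
  by move=> /(alpha_starE _ bK rxi); exact.
by apply: contrapT => nU; apply: h; apply/alpha_starE.
Qed.

End BorelMeasurability.

(** * Integration on the sphere *)

Section SphereIntegrals.
Context {R : realType} {m : nat}.
Notation V := 'rV[R]_m.+1.
Notation T := (borelRn R m.+1).
Variable nu : {measure set T -> \bar R}.
Hypothesis nuS : sph_measure nu.
Implicit Types (f g : V -> R) (A : set V) (v u : V).

Lemma sph_mass : nu setT = nu sphere.
Proof.
have [nu0 _] := nuS.
rewrite -(setUv sphere) measureU.
- by rewrite [X in (_ + X)%E](nu0 : nu (~` sphere) = 0%E) adde0.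
- exact: measurable_sphere.
- by apply: measurableC; exact: measurable_sphere.
- by rewrite setICr.
Qed.

Lemma sph_mass_fin A : measurable (A : set T) -> nu A \is a fin_num.
Proof.
move=> mA; rewrite ge0_fin_numE//; apply: le_lt_trans nuS.2.2.
by apply: le_measure; rewrite ?inE.
Qed.

Lemma sph_mass_gt0 : 0 < fine (nu sphere).
Proof. by apply: fine_gt0; rewrite -sph_mass; apply/andP; exact: nuS.2. Qed.

Lemma bounded_sph_integrable f (M : R) : measurable_fun (sphere : set T) (f : T -> R) ->
  (forall u, sphere u -> `|f u| <= M) -> nu.-integrable (sphere : set T) (EFin \o f).
Proof.
move=> mf fM; apply: measurable_bounded_integrable => //.
- exact: measurable_sphere.
- by rewrite -ge0_fin_numE// sph_mass_fin//; exact: measurable_sphere.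
- exists M; split; first exact: num_real.
  by move=> M' MM' u su /=; rewrite (le_trans (fM _ su))// ltW.
Qed.

Lemma continuous_sph_bounded f : {within sphere, continuous f} ->
  exists2 M, 0 < M & forall u, sphere u -> `|f u| <= M.
Proof.
move=> fc; have [M [_ h]] := compact_bounded (continuous_compact fc compact_sphere).
exists (`|M| + 1) => [|u su]; first by rewrite ltr_wpDl.
by apply: (h (`|M| + 1)); [rewrite (le_lt_trans (ler_norm M))// ltrDl|exists u].
Qed.

Lemma continuous_sph_integrable f : {within sphere, continuous f} ->
  nu.-integrable (sphere : set T) (EFin \o f).
Proof.
move=> fc; have [M _ fM] := continuous_sph_bounded fc.
by apply: bounded_sph_integrable fM; exact: measurable_within_sphere.
Qed.

(** The lower estimate behind all a priori bounds: a large value [c1] on the part of the sphere off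
    a slab has to outweigh [c2] on the rest. *)
Lemma Rintegral_two_level f A (c1 c2 : R) : measurable (A : set T) -> A `<=` sphere ->
  nu.-integrable (sphere : set T) (EFin \o f) ->
  (forall x, A x -> c1 <= f x) -> (forall x, sphere x -> ~ A x -> c2 <= f x) ->
  c1 * fine (nu A) + c2 * fine (nu (sphere `\` A)) <= \int[nu]_(x in (sphere : set T)) f x.
Proof.
move=> mA AS fint f1 f2.
have mS : measurable (sphere : set T) := measurable_sphere.
have mSA : measurable (sphere `\` A : set T) by exact: measurableD.
have SE : sphere = A `|` (sphere `\` A) :> set T by rewrite setDE setUIr setUCr setIT setUidr.
have cint B c : measurable (B : set T) -> nu.-integrable (B : set T) (EFin \o (fun=> c : R)).
  move=> mB; apply: measurable_bounded_integrable => //.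
    by rewrite -ge0_fin_numE// sph_mass_fin.
  by exists `|c|; split => // M cM x _ /=; exact: ltW.
rewrite [in leRHS]SE Rintegral_setU//; last 2 first.
- by rewrite -SE.
- by apply/disj_setPS => x [Ax [_ /(_ Ax)]].
rewrite -!Rintegral_cst//; apply: lerD; apply: le_Rintegral => //; try exact: cint.
- exact: integrableS fint.
- by apply: integrableS fint => // x [].
- by move=> x [sx nAx]; exact: f2.
Qed.

Definition slab v (d : R) : set V := sphere `&` [set u | `|dotv v u| <= d].

Lemma measurable_slab v d : measurable (slab v d : set T).
Proof.
apply: closed_borel; apply: closedI; first exact: closed_sphere.
rewrite (_ : [set u | _] = (fun u : V => `|dotv v u|) @^-1` [set t | t <= d])//.
apply: closed_comp; last exact: closed_le.
move=> u _; apply: (@cvg_norm _ _ _ (nbhs u)); exact: dotvr_continuous.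
Qed.

Lemma fine_measure_le A (B : set V) : measurable (A : set T) -> measurable (B : set T) -> A `<=` B ->
  fine (nu A) <= fine (nu B).
Proof.
move=> mA mB AB; apply: fine_le; rewrite ?sph_mass_fin//.
by apply: le_measure; rewrite ?inE.
Qed.

Lemma fine_measure_diff A : measurable (A : set T) -> A `<=` sphere ->
  fine (nu (sphere `\` A)) = fine (nu sphere) - fine (nu A).
Proof.
move=> mA AS; have mS : measurable (sphere : set T) := measurable_sphere.
have -> : nu sphere = (nu A + nu (sphere `\` A))%E.
  rewrite -measureU ?setDIK//; [|exact: measurableD].
  by rewrite setDE setUIr setUCr setIT setUidr.
by rewrite fineD ?sph_mass_fin//; [ring|exact: measurableD].
Qed.

(** Slabs decrease to the great subsphere, so their masses converge by continuity from above. Adding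
    [d] to the mass makes one number serve as width and as margin. *)
Lemma slab_great_subsphere v (a : R) : fine (nu (great_subsphere v)) < a ->
  exists2 d, 0 < d & fine (nu (slab v d)) + d < a.
Proof.
move=> va.
have h : (fun k => fine (nu (slab v k.+1%:R^-1)) + k.+1%:R^-1) @ \oo -->
    fine (nu (great_subsphere v)) + 0.
  apply: cvgD; last exact: cvg_harmonic.
  apply: fine_cvg; rewrite fineK; last by apply: sph_mass_fin; exact: measurable_great_subsphere.
  rewrite (_ : great_subsphere v = \bigcap_k slab v k.+1%:R^-1); last first.
    apply/seteqP; split=> [u [su vu] k _|u uslab].
      by split=> //=; rewrite vu normr0 invr_ge0.
    have [su _] := uslab 0 Logic.I; split=> //.
    apply/eqP; rewrite -normr_le0; apply/ler_addgt0Pr => e e0; rewrite add0r.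
    have [_ /= /le_trans] := uslab (Num.truncn e^-1) Logic.I; apply.
    by rewrite invf_ple ?posrE// ltW// truncnS_gt.
  apply: nonincreasing_cvg_mu.
  - by rewrite -ge0_fin_numE// sph_mass_fin//; exact: measurable_slab.
  - by move=> k; exact: measurable_slab.
  - by apply: bigcapT_measurable => k; exact: measurable_slab.
  - move=> k l kl; apply/subsetPset => u [su /= h]; split=> //=; apply: le_trans h _.
    by rewrite lef_pV2 ?posrE// ler_nat.
rewrite addr0 in h.
have /cvgrPdist_lt/(_ (a - fine (nu (great_subsphere v)))) := h.
rewrite subr_gt0 => /(_ va) [k _ /(_ k (leqnn k))/= hk].
exists k.+1%:R^-1; first by rewrite invr_gt0.
by move: hk; rewrite ltr_norml => /andP[+ _]; rewrite ltrNl opprB ltrBlDr subrK.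
Qed.

(** A slab of half the width around a nearby [v'] lies inside the slab of [v] on the sphere;
    compactness of the sphere then gives one width for all [v]. *)
Lemma slab_uniform (a : R) :
  (forall v, sphere v -> fine (nu (great_subsphere v)) < a) ->
  exists2 d, 0 < d & forall v, sphere v -> fine (nu (slab v d)) + d < a.
Proof.
move=> ha.
have /compact_near_coveringP/near_covering_withinP cS := @compact_sphere R m.+1.
have : \forall d \near (0 : R)^'+, sphere `<=` [set v : V | fine (nu (slab v d)) + d < a].
  apply: cS => v sv.
  have [d d0 dv] := slab_great_subsphere (ha _ sv).
  (* By [dotv_norm], this radius keeps [dotv (v - v') u] below [d / 2], and the other half of [d] is
     the width of the slab of [v']. *)
  exists (ball v (d / (2 * m.+1%:R)), [set d' | 0 < d' <= d / 2]) => /=.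
    split; first by apply: nbhsx_ballx; rewrite divr_gt0// mulr_gt0.
    near=> t; apply/andP; split; first by near: t; exact: nbhs_right_gt.
    by near: t; apply: nbhs_right_le; rewrite divr_gt0.
  move=> [v' d'] /= [vv' /andP[d'0 d'd]] sv'.
  apply: le_lt_trans dv; apply: lerD; last by lra.
  apply: fine_measure_le; [exact: measurable_slab|exact: measurable_slab|].
  move=> u [su /= h]; split => //=.
  have -> : dotv v u = dotv v' u + dotv (v - v') u by rewrite dotvBl; ring.
  apply: (le_trans (ler_normD _ _)).
  have : `|dotv (v - v') u| <= d / 2; last by lra.
  apply: (le_trans (dotv_norm _ _)).
  apply: (@le_trans _ _ (m.+1%:R * `|v - v'| * 1)).
    by rewrite ler_wpM2l ?mulr_ge0// sphere_norm.
  move: vv'; rewrite -ball_normE/= => /ltW vv'; rewrite mulr1.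
  apply: (le_trans (ler_wpM2l _ vv')); first by [].
  by rewrite le_eqVlt; apply/orP; left; apply/eqP; field.
move=> h.
have [d [d0 dQ]] := filter_ex (filterI (nbhs_right_gt (0 : R)) h).
by exists d.
Unshelve. all: by end_near. Qed.

End SphereIntegrals.

(** * The functional to minimize and the constraint *)

Section Functionals.
Context {R : realType} {m : nat}.
Notation V := 'rV[R]_m.+1.
Notation T := (borelRn R m.+1).
Implicit Types (f g : V -> R) (K : set V) (u v xi : V).

(** For the support function of a body this is minus the integral of the logarithm of the radial
    function, by [radial_gauge]. *)
Definition potential (lambda : {measure set T -> \bar R}) f : R :=
  \int[lambda]_(xi in (sphere : set T)) ln (gauge f xi).

Definition energy (mu : {measure set T -> \bar R}) (Psi : V -> R -> R) f : R :=
  \int[mu]_(u in (sphere : set T)) Psi u (f u).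

(** The common ground of the two cases: it holds for [Psi] in (i) and for its negative in (ii). All
    that differs between them enters through [apriori_bounds]. *)
Definition class_inc (Psi : V -> R -> R) := class_C Psi /\
  forall u t, sphere u -> 0 < t -> 0 < Psi_t Psi u t.

(** Potential at most 0 means not worse than the unit ball. The requirement [r <= 1 <= M] keeps the
    ball itself inside the class that is minimized over. *)
Definition apriori_bounds lambda mu Psi := exists r M, [/\ 0 < r, r <= 1, 1 <= M &
  forall K, convex_body_e K ->
    energy mu Psi (support_fun K) <= energy mu Psi (fun=> 1) ->
    potential lambda (support_fun K) <= 0 ->
    forall u, sphere u -> r <= support_fun K u <= M].

Lemma comp_graph_continuous (g : V * R -> R) f : {within domSR, continuous g} ->
  pos_cont f -> {within sphere, continuous (fun u => g (u, f u))}.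
Proof.
move=> /subspace_continuousP gc [/within_sphere_continuousP fc f0].
apply/within_sphere_continuousP => x sx.
have := gc (x, f x); rewrite /domSR/= => /(_ (conj sx (f0 _ sx))) gx.
apply: (@cvg_trans _ (g @ within domSR (nbhs (x, f x)))) gx.
have hc : (u, f u) @[u --> within sphere (nbhs x)] --> (x, f x).
  have hid : id @ within sphere (nbhs x) --> x by apply: cvg_within.
  exact: (@cvg_pair _ _ _ (within sphere (nbhs x)) (nbhs x) (nbhs (f x)) _ _ _ id f hid (fc _ sx)).
move=> A /= hA; have := hc _ hA; rewrite /= /within/= !near_simpl => hx.
apply: (@filterS _ (nbhs x) _ _ _ _ hx) => u hu su; apply: hu => //; split=> //; exact: f0.
Qed.

Lemma pos_cont_cst (c : R) : 0 < c -> pos_cont (fun _ : V => c).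
Proof. by move=> c0; split=> // x; exact: cst_continuous. Qed.

Lemma gauge_cst1 xi : sphere xi -> gauge (fun=> 1) xi = 1.
Proof.
move=> sxi; have p1 := pos_cont_cst (@ltr01 R).
apply/eqP; rewrite eq_le; apply/andP; split.
  by apply: gauge_le => // u su; rewrite divr1 dotv_sphere_le1.
by apply: le_trans (gauge_ge xi p1 sxi); rewrite sxi divr1.
Qed.

Lemma potential_cst1 lambda : potential lambda (fun=> 1) = 0.
Proof.
rewrite /potential (@eq_Rintegral _ _ _ _ _ (fun=> 0)); last first.
  by move=> xi; rewrite inE => sxi; rewrite gauge_cst1// ln1.
by rewrite Rintegral_cst ?mul0r//; exact: measurable_sphere.
Qed.

Lemma ln_gauge_continuous f : pos_cont f -> {within sphere, continuous (fun xi => ln (gauge f xi))}.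
Proof.
move=> pf; apply: continuous_in_subspaceT => x; rewrite inE => sx.
have h := @continuous_comp V R R (gauge f) (@ln R) x. apply: h; first exact: gauge_continuous.
by apply: continuous_ln; exact: gauge_gt0.
Qed.

Variable Psi : V -> R -> R.
Hypothesis Psi_inc : class_inc Psi.

Lemma Psi_comp_continuous f : pos_cont f -> {within sphere, continuous (fun u => Psi u (f u))}.
Proof. by move=> pf; exact: (comp_graph_continuous Psi_inc.1.1 pf). Qed.

Lemma Psi_t_comp_continuous f : pos_cont f -> {within sphere, continuous (fun u => Psi_t Psi u (f u))}.
Proof. by move=> pf; exact: (comp_graph_continuous Psi_inc.1.2.2 pf). Qed.

Lemma Psi_MVT u (s t : R) : sphere u -> 0 < s -> s <= t ->
  exists2 c, s <= c <= t & Psi u t - Psi u s = Psi_t Psi u c * (t - s).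
Proof.
move=> su s0 st.
have [||c] := @MVT_segment R (Psi u) (Psi_t Psi u) s t st.
- move=> x; rewrite in_itv/= => /andP[sx _].
  rewrite /Psi_t derive1E; apply: derivableP; apply: Psi_inc.1.2.1 => //.
  exact: lt_trans sx.
- apply: derivable_within_continuous => x; rewrite in_itv/= => /andP[sx _].
  by apply: Psi_inc.1.2.1 => //; exact: lt_le_trans sx.
by rewrite in_itv/= => cst E; exists c.
Qed.

Lemma Psi_le u (s t : R) : sphere u -> 0 < s -> s <= t -> Psi u s <= Psi u t.
Proof.
move=> su s0 st; have [c /andP[sc _] E] := Psi_MVT su s0 st.
rewrite -subr_ge0 E mulr_ge0 ?subr_ge0//.
by apply/ltW; apply: Psi_inc.2 => //; exact: lt_le_trans sc.
Qed.

Lemma energy_le mu f g : sph_measure mu -> pos_cont f -> pos_cont g ->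
  (forall u, sphere u -> f u <= g u) -> energy mu Psi f <= energy mu Psi g.
Proof.
move=> muS pf pg fg; apply: le_Rintegral.
- exact: measurable_sphere.
- by apply: continuous_sph_integrable => //; exact: Psi_comp_continuous.
- by apply: continuous_sph_integrable => //; exact: Psi_comp_continuous.
- by move=> u su; apply: Psi_le => //; [exact: pf.2|exact: fg].
Qed.

(* A symmetric body contains a segment [-M v, M v] with [M] at least the maximum
   of its support function. *)
Lemma support_ge_segment K u0 : convex_body_e K -> sphere u0 ->
  exists2 v, sphere v & forall u, sphere u -> support_fun K u0 * `|dotv v u| <= support_fun K u.
Proof.
move=> eK su0; have [bK sK] := eK.
have [x Kx hx] := support_realized u0 bK.
have h0 := support_gt0 bK su0.
have x0 : x != 0 by apply: contraTneq h0 => x0; rewrite hx x0 dotvC dotv0l ltxx.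
exists (unitv x); first exact: sphere_unitv.
move=> u su.
have s0 : 0 < Num.sqrt (dotv x x) by rewrite sqrtr_gt0 dotvv_gt0.
have hs : support_fun K u0 <= Num.sqrt (dotv x x).
  have := dotv_sphere_le1 su0 (sphere_unitv x0).
  by rewrite /unitv dotvZr -hx mulrC ler_pdivrMr// mul1r.
have : `|dotv x u| <= support_fun K u.
  rewrite ler_norml lerNl -dotvNl dotvC (dotvC x) !support_ge//; exact: sK.
apply: le_trans; rewrite /unitv dotvZl normrM (gtr0_norm (_ : 0 < _^-1)) ?invr_gt0//.
by rewrite mulrA -[leRHS]mul1r ler_wpM2r// ler_pdivrMr// mul1r.
Qed.

End Functionals.

(** * A priori bounds for admissible bodies *)

Section AprioriBounds.
Context {R : realType} {m : nat}.
Notation V := 'rV[R]_m.+1.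
Notation T := (borelRn R m.+1).
Implicit Types (f g : V -> R) (K : set V) (u v xi : V).

Lemma pos_cont_extrema f : pos_cont f ->
  exists w u, [/\ sphere w, sphere u & forall v, sphere v -> f w <= f v <= f u].
Proof.
move=> [fc f0].
have [u + umax] := compact_EVT_max sphere_nonempty compact_sphere fc.
have [w + wmin] := compact_EVT_min sphere_nonempty compact_sphere fc.
rewrite !inE => sw su; exists w, u; split=> // v sv.
by rewrite wmin ?umax// inE.
Qed.

(** By evenness the Wulff shape lies in the strip of half-width [f w] orthogonal to [w]; a thin
    strip forces a large gauge off its hyperplane. *)
Lemma gauge_ge_strip f w xi : pos_cont f -> (forall u, sphere u -> f (- u) = f u) ->
  sphere w -> `|dotv w xi| / f w <= gauge f xi.
Proof.
move=> pf fe sw; rewrite ler_pdivrMr ?pf.2// ler_norml lerNl -dotvNl.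
have fw := pf.2 _ sw; apply/andP; split.
  by rewrite -ler_pdivrMr// -(fe w sw) gauge_ge//; exact: sphereN.
by rewrite -ler_pdivrMr// gauge_ge.
Qed.

Variables (lambda mu : {measure set T -> \bar R}) (Psi : V -> R -> R).
Hypotheses (lambdaS : sph_measure lambda) (muS : sph_measure mu).
Hypothesis Psi_inc : class_inc Psi.

Lemma not_concentrated_great_subsphere (nu : {measure set T -> \bar R}) :
  sph_measure nu -> not_concentrated nu ->
  forall v, sphere v -> fine (nu (great_subsphere v)) < fine (nu sphere).
Proof.
move=> nuS nc v sv; rewrite -subr_gt0 -fine_measure_diff//; last 2 first.
- exact: measurable_great_subsphere.
- by move=> x [].
apply: fine_gt0; rewrite nc//= -ge0_fin_numE// sph_mass_fin//.
by apply: measurableD; [exact: measurable_sphere|exact: measurable_great_subsphere].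
Qed.

Lemma slab_complement_mass (nu : {measure set T -> \bar R}) (d : R) v :
  sph_measure nu -> fine (nu (slab v d)) + d < fine (nu sphere) ->
  d < fine (nu (sphere `\` slab v d)).
Proof.
move=> nuS h; rewrite fine_measure_diff//; [lra|exact: measurable_slab|by move=> x []].
Qed.

Section Increasing.
Hypotheses (lambda_nc : not_concentrated lambda) (mu_nc : not_concentrated mu).
Hypothesis Psi_gt0 : forall u t, sphere u -> 0 < t -> 0 < Psi u t.
Hypothesis Psi_pinfty : forall u, sphere u -> Psi u t @[t --> +oo] --> +oo.

(** A Dini argument: continuity at one fixed level spreads the bound to nearby [u], monotonicity to
    all higher levels, and compactness makes it uniform. *)
Lemma Psi_uniform_pinfty (L : R) : exists2 t0, 0 < t0 &
  forall u t, sphere u -> t0 <= t -> L <= Psi u t.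
Proof.
have /compact_near_coveringP/near_covering_withinP cS := @compact_sphere R m.+1.
have : \forall k \near \oo, sphere `<=` [set u : V | L <= Psi u k.+1%:R].
  apply: cS => u su.
  have /cvgryPgt/(_ L)[M [_ hM]] := Psi_pinfty su.
  pose k := Num.truncn `|M|.
  have Mk : M < k.+1%:R by rewrite (le_lt_trans (ler_norm _))// truncnS_gt.
  have k0 : 0 < k.+1%:R :> R by [].
  have /within_sphere_continuousP/(_ u su) := Psi_comp_continuous Psi_inc (pos_cont_cst k0).
  move=> /cvgr_gt/(_ _ (hM _ Mk)).
  rewrite near_withinE => hu.
  exists ([set u' | sphere u' -> L < Psi u' k.+1%:R], [set l | (k <= l)%N]) => /=.
    by split=> //; exists k.
  move=> [u' l] [/= h1 kl] su'; apply: (le_trans (ltW (h1 su'))).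
  by apply: Psi_le => //; rewrite ler_nat.
move=> [k _ hk]; exists k.+1%:R => // u t su kt.
apply: (le_trans (hk k (leqnn k) u su)); exact: Psi_le.
Qed.

Lemma apriori_increasing : apriori_bounds lambda mu Psi.
Proof.
have [d d0 hd] := slab_uniform muS (not_concentrated_great_subsphere muS mu_nc).
have [d' d'0 hd'] := slab_uniform lambdaS (not_concentrated_great_subsphere lambdaS lambda_nc).
pose c := energy mu Psi (fun=> 1).
(* Outside a slab the mass of [mu] exceeds [d], so [Psi] being at least [L] there, and positive
   elsewhere, pushes the energy above [c]. *)
pose L := (`|c| + 1) / d.
have L0 : 0 < L by rewrite divr_gt0// ltr_wpDl.
have [t0 t00 ht0] := Psi_uniform_pinfty L.
(* If some value of [h] exceeds [t0 / d], the segment inside the body gives [h >= t0] outside a slab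
   of width [d]. *)
pose M := Num.max 1 (t0 / d).
have M1 : 1 <= M by rewrite le_max lexx.
have M0 : 0 < M by exact: lt_le_trans M1.
have ub K : convex_body_e K -> energy mu Psi (support_fun K) <= c ->
    forall u, sphere u -> support_fun K u <= M.
  move=> eK Kc u su; rewrite leNgt; apply/negP => Mu.
  have pK := support_pos_cont eK.1.
  have [v sv hv] := support_ge_segment eK su.
  have mA : measurable (sphere `\` slab v d : set T).
    by apply: measurableD; [exact: measurable_sphere|exact: measurable_slab].
  have := @Rintegral_two_level _ _ mu muS (fun u => Psi u (support_fun K u)) _ L 0 mA (fun x h => h.1).
  move=> /(_ (continuous_sph_integrable muS (Psi_comp_continuous Psi_inc pK))).
  rewrite mul0r addr0 leNgt => /(_ _ _)/negP; apply.
  - move=> x [sx nx]; apply: ht0 => //; apply: le_trans (hv _ sx).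
    have dx : d < `|dotv v x|.
      by rewrite ltNge; apply/negP => h; apply: nx.
    have : t0 / d < support_fun K u by apply: le_lt_trans Mu; rewrite le_max lexx orbT.
    rewrite ltr_pdivrMr// => /ltW h; apply: (le_trans h).
    by rewrite ler_wpM2l// ltW// pK.2.
  - by move=> x sx _; apply/ltW/Psi_gt0 => //; exact: pK.2.
  - apply: (le_lt_trans Kc); apply: (@lt_le_trans _ _ (L * d)).
      by rewrite /L divfK ?gt_eqF// (le_lt_trans (ler_norm _))// ltrDl.
    by rewrite ler_wpM2l ?(ltW L0)// ltW// slab_complement_mass// hd.
(* With minimal value [h < d'], the log-gauge is at least [ln (d' / h)] off the slab and at least
   [- ln M] on it. Nonpositive potential then forces [ln (d' / h) <= B]. *)
pose B := ln M * fine (lambda sphere) / d'.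
have lnM0 : 0 <= ln M by exact: ln_ge0.
have B0 : 0 <= B by rewrite divr_ge0 ?mulr_ge0 ?(ltW d'0)// ltW// sph_mass_gt0.
pose r := Num.min 1 (d' * expR (- B)).
exists r, M; split=> //.
- by rewrite lt_min ltr01 mulr_gt0// expR_gt0.
- by rewrite ge_min lexx.
move=> K eK Kc Kp u su; rewrite (ub K eK Kc u su) andbT.
have pK := support_pos_cont eK.1.
have [w [u1 [sw _ hw]]] := pos_cont_extrema pK.
have /andP[+ _] := hw _ su; apply: le_trans.
set h := support_fun K w; have h0 : 0 < h by exact: pK.2.
rewrite ge_min; case: (leP 1 h) => //= h1.
case: (leP d' h) => d'h.
  apply: le_trans d'h; rewrite -[leRHS]mulr1 ler_wpM2l ?(ltW d'0)//.
  by rewrite -expR0 ler_expR oppr_le0.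
have mA : measurable (sphere `\` slab w d' : set T).
  by apply: measurableD; [exact: measurable_sphere|exact: measurable_slab].
have := @Rintegral_two_level _ _ lambda lambdaS (fun xi => ln (gauge (support_fun K) xi)) _
  (ln (d' / h)) (- ln M) mA (fun x h => h.1)
  (continuous_sph_integrable lambdaS (ln_gauge_continuous pK)).
have step1 x : (sphere `\` slab w d') x -> ln (d' / h) <= ln (gauge (support_fun K) x).
  move=> [sx nx]; rewrite ler_ln ?posrE ?divr_gt0 ?gauge_gt0//.
  have dx : d' < `|dotv w x|.
    by rewrite ltNge; apply/negP => h'; apply: nx.
  apply: le_trans (gauge_ge_strip x pK (fun u _ => support_even u eK) sw).
  by rewrite ler_pM2r ?invr_gt0// ltW.
have step2 x : sphere x -> ~ (sphere `\` slab w d') x -> - ln M <= ln (gauge (support_fun K) x).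
  move=> sx _; rewrite -lnV ?posrE// ler_ln ?posrE ?invr_gt0 ?gauge_gt0//.
  apply: le_trans (gauge_ge x pK sx).
  by rewrite sx mul1r lef_pV2 ?posrE ?pK.2// ub.
move=> /(_ step1 step2) key.
have {}key := le_trans key Kp.
have lc := slab_complement_mass lambdaS (hd' _ sw).
have le1 : fine (lambda (sphere `\` (sphere `\` slab w d'))) <= fine (lambda sphere).
  have mS : measurable (sphere : set T) := measurable_sphere.
  by apply: fine_measure_le => //; exact: measurableD.
have l0 : 0 <= ln (d' / h).
  by apply: ln_ge0; rewrite ler_pdivlMr// mul1r ltW.
have hB : ln (d' / h) <= B.
  rewrite ler_pdivlMr//.
  have : ln (d' / h) * d' <= ln (d' / h) * fine (lambda (sphere `\` slab w d')).
    by rewrite ler_wpM2l// ltW.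
  have : ln M * fine (lambda (sphere `\` (sphere `\` slab w d'))) <= ln M * fine (lambda sphere).
    by rewrite ler_wpM2l.
  rewrite mulNr in key; lra.
move: hB; rewrite -ler_expR lnK ?posrE ?divr_gt0// ler_pdivrMr// => hB.
by rewrite expRN ler_pdivrMr ?expR_gt0// mulrC.
Qed.

End Increasing.
End AprioriBounds.

(* The integral of a non-measurable function is defined as an inner integral;
   comparison off a null set still holds for it. *)
Section IntegralOffNullSet.
Local Open Scope ereal_scope.
Context d (T : measurableType d) (R : realType) (mu : {measure set T -> \bar R}).
Implicit Types (f g : T -> \bar R) (N : set T).
Import HBNNSimple.

(** A simple function below [f], set to 0 on [N], lies below [g] and keeps its integral. *)
Lemma ge0_le_integral_off_null f g N : measurable N -> mu N = 0 ->
  (forall x, 0 <= f x) -> (forall x, 0 <= g x) -> (forall x, ~ N x -> f x <= g x) ->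
  \int[mu]_x f x <= \int[mu]_x g x.
Proof.
move=> mN N0 f0 g0 fg; rewrite (ge0_integralTE _ f0) (ge0_integralTE _ g0).
apply: ge_ereal_sup => _ [h hf <-].
have mNC : measurable (~` N) by exact: measurableC.
apply: ereal_sup_ubound; exists (proj_nnsfun h mNC).
  move=> x /=; rewrite mindicE; have [|/negP nx] := boolP (x \in ~` N).
    by rewrite inE mulr1 => /fg; apply: le_trans; exact: hf.
  by rewrite mulr0.
rewrite -!integralT_nnsfun [RHS](@ge0_negligible_integral _ _ _ mu setT N)//; last 2 first.
- by apply/measurable_EFinP.
- by move=> x _; rewrite lee_fin.
rewrite setTD [RHS]integral_mkcond; apply: eq_integral => x _.
by rewrite patchE/= mindicE; case: (x \in ~` N); rewrite ?mulr1 ?mulr0.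
Qed.

Lemma eq_integral_off_null f g N : measurable N -> mu N = 0 ->
  (forall x, ~ N x -> f x = g x) -> \int[mu]_x f x = \int[mu]_x g x.
Proof.
move=> mN N0 fg.
have ge0_eq f' g' : (forall x, 0 <= f' x) -> (forall x, 0 <= g' x) ->
    (forall x, ~ N x -> f' x = g' x) -> \int[mu]_x f' x = \int[mu]_x g' x.
  move=> f0 g0 E; apply/eqP; rewrite eq_le; apply/andP.
  by split; apply: ge0_le_integral_off_null N0 _ _ _ => // x /E ->.
rewrite integralE [RHS]integralE; congr (_ - _).
  by apply: ge0_eq => // x /fg; rewrite !funeposE => ->.
by apply: ge0_eq => // x /fg; rewrite !funenegE => ->.
Qed.

End IntegralOffNullSet.

(** * A priori bounds from the logarithmic integral *)

Section AprioriVanishing.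
Context {R : realType} {m : nat}.
Notation V := 'rV[R]_m.+1.
Notation T := (borelRn R m.+1).
Variables (lambda mu : {measure set T -> \bar R}) (Psi : V -> R -> R).
Hypotheses (lambdaS : sph_measure lambda) (muS : sph_measure mu).
Hypothesis Psi_inc : class_inc Psi.
Hypothesis mu_vanish : vanishes_on_great_subspheres mu.
Variable C : R.
Hypothesis log_int : (C%:E < ereal_inf
  [set (\int[lambda]_(xi in (sphere : set T)) logabs v xi)%E | v in sphere])%E.

Let le_maxe2 (a b : \bar R) : (a <= b)%E -> (maxe a 0 <= maxe b 0)%E.
Proof.
by move=> ab; rewrite ge_max !le_max lexx orbT andbT ab.
Qed.

(** The logarithm of the strip estimate, integrated; where [w] and [xi] are orthogonal it holds
    because [logabs] is minus infinity. *)
Lemma potential_ge_log K w : convex_body_e K -> sphere w ->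
  C - ln (support_fun K w) * fine (lambda sphere) <= potential lambda (support_fun K).
Proof.
move=> eK sw; have pK := support_pos_cont eK.1.
have mS : measurable (sphere : set T) := measurable_sphere.
have Cw : (C%:E < \int[lambda]_(xi in (sphere : set T)) logabs w xi)%E.
  by apply: (lt_le_trans log_int); apply: ereal_inf_lbound; exists w.
set h := support_fun K; pose phi xi := ln (gauge h xi) + ln (h w).
have hw0 : 0 < h w by exact: pK.2.
have phic : {within sphere, continuous phi}.
  apply: within_continuousD; first exact: ln_gauge_continuous.
  by apply: continuous_subspaceT; exact: cst_continuous.
have logphi xi : sphere xi -> (logabs w xi <= (phi xi)%:E)%E.
  move=> sxi; rewrite /logabs; case: eqVneq => [_|n0]; first by rewrite leNye.
  have d0 : 0 < `|dotv w xi| by rewrite normr_gt0.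
  rewrite lee_fin -lerBlDr -ln_div ?posrE// ler_ln ?posrE ?divr_gt0 ?gauge_gt0//.
  by apply: gauge_ge_strip => // u _; exact: support_even.
have phiint := continuous_sph_integrable lambdaS phic.
have -> : potential lambda h = \int[lambda]_(xi in (sphere : set T)) phi xi -
    ln (h w) * fine (lambda sphere).
  rewrite /phi RintegralD//; last 2 first.
  - by apply: continuous_sph_integrable => //; exact: ln_gauge_continuous.
  - by apply: continuous_sph_integrable => //; apply: continuous_subspaceT; exact: cst_continuous.
  by rewrite Rintegral_cst// addrK.
rewrite lerB// -lee_fin /Rintegral fineK; last exact: integrable_fin_num.
apply: (le_trans (ltW Cw)).
(* Positive and negative parts are compared separately with empty exceptional set, which avoids
   establishing measurability of [logabs w]. *)
rewrite [leLHS]integralE [leRHS]integralE.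
apply: leeB; rewrite [leLHS]integral_mkcond [leRHS]integral_mkcond;
  apply: (@ge0_le_integral_off_null _ _ _ lambda _ _ set0) => //.
- by move=> x; rewrite patchE; case: ifPn.
- by move=> x; rewrite patchE; case: ifPn.
- move=> x _; rewrite !patchE; case: ifPn => //; rewrite inE => /logphi hx.
  by rewrite !funeposE; apply: le_maxe2.
- by move=> x; rewrite patchE; case: ifPn.
- by move=> x; rewrite patchE; case: ifPn.
- move=> x _; rewrite !patchE; case: ifPn => //; rewrite inE => /logphi hx.
  by rewrite !funenegE; apply: le_maxe2; rewrite ?leeN2.
Qed.

Lemma apriori_vanishing : apriori_bounds lambda mu Psi.
Proof.
have mS : measurable (sphere : set T) := measurable_sphere.
pose l := fine (lambda sphere); have l0 : 0 < l by exact: sph_mass_gt0.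
(* [potential_ge_log] with nonpositive potential reads [C <= ln (h u) * l]. *)
pose r := Num.min 1 (expR (C / l)).
have r0 : 0 < r by rewrite lt_min ltr01 expR_gt0.
have r1 : r <= 1 by rewrite ge_min lexx.
have lb K : convex_body_e K -> potential lambda (support_fun K) <= 0 ->
    forall u, sphere u -> r <= support_fun K u.
  move=> eK K0 u su; have pK := support_pos_cont eK.1.
  have := le_trans (potential_ge_log eK su) K0; rewrite subr_le0 -ler_pdivrMr//.
  rewrite -ler_expR lnK ?posrE ?pK.2// => h; apply: le_trans h.
  by rewrite ge_min lexx orbT.
have two0 : 0 < 2 :> R by [].
(* [Psi] has no prescribed sign or limit here, so only differences from the level 1 are used: they
   are at least [e] where [h >= 2], and at least [- B] wherever [h >= r]. *)
pose phi u := Psi u 2 - Psi u 1.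
have phi0 u : sphere u -> 0 < phi u.
  move=> su; have [c /andP[c1 _] E] := Psi_MVT Psi_inc su ltr01 (ler1n _ 2).
  rewrite /phi E.
  by rewrite mulr_gt0 ?Psi_inc.2//; lra.
have pcphi : pos_cont phi.
  split=> //; apply: within_continuousB; apply: Psi_comp_continuous => //; exact: pos_cont_cst.
have [e [M1 [e0 _ hphi]]] := pos_cont_bounds pcphi.
have [B B0 hB] : exists2 B, 0 < B & forall u, sphere u -> `|Psi u r - Psi u 1| <= B.
  apply: continuous_sph_bounded.
  apply: within_continuousB; apply: Psi_comp_continuous => //; exact: pos_cont_cst.
pose M0 := fine (mu sphere); have M00 : 0 < M0 by exact: sph_mass_gt0.
(* The threshold mass: [e * (M0 - s) - B * s] is positive exactly when the slab mass [s] is below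
   [a]. *)
pose a := e * M0 / (e + B).
have eB : 0 < e + B by rewrite addr_gt0.
have a0 : 0 < a by rewrite divr_gt0// mulr_gt0.
have [d d0 hd] : exists2 d, 0 < d & forall v, sphere v -> fine (mu (slab v d)) + d < a.
  by apply: slab_uniform => // v sv; rewrite mu_vanish.
exists r, (Num.max 1 (2 / d)); split=> //; first by rewrite le_max lexx.
move=> K eK Kc K0 u su; rewrite lb//=.
rewrite leNgt; apply/negP => Mu.
have pK := support_pos_cont eK.1; have p1 := pos_cont_cst (@ltr01 R).
have [v sv hv] := support_ge_segment eK su.
have mA : measurable (sphere `\` slab v d : set T).
  by apply: measurableD => //; exact: measurable_slab.
pose psi u := Psi u (support_fun K u) - Psi u 1.
have psic : {within sphere, continuous psi}.
  by apply: within_continuousB; apply: Psi_comp_continuous.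
have := @Rintegral_two_level _ _ mu muS psi _ e (- B) mA (fun x h => h.1)
  (continuous_sph_integrable muS psic).
have step1 x : (sphere `\` slab v d) x -> e <= psi x.
  move=> [sx nx]; have /andP[ex _] := hphi _ sx; apply: (le_trans ex).
  rewrite /phi /psi lerD2r; apply: Psi_le => //; apply: le_trans (hv _ sx).
  have dx : d < `|dotv v x|.
    by rewrite ltNge; apply/negP => h; apply: nx.
  have : 2 / d < support_fun K u by apply: le_lt_trans Mu; rewrite le_max lexx orbT.
  rewrite ltr_pdivrMr// => /ltW h; apply: (le_trans h).
  by rewrite ler_wpM2l// ltW// pK.2.
have step2 x : sphere x -> ~ (sphere `\` slab v d) x -> - B <= psi x.
  move=> sx _; have := hB _ sx; rewrite ler_norml => /andP[h _]; apply: (le_trans h).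
  by rewrite /psi lerD2r; apply: Psi_le => //; exact: lb.
move=> /(_ step1 step2).
rewrite /psi RintegralB//; last 2 first.
- by apply: continuous_sph_integrable => //; exact: Psi_comp_continuous.
- by apply: continuous_sph_integrable => //; exact: Psi_comp_continuous.
move=> key.
have {}key := le_trans key (_ : _ <= 0); move: key; rewrite subr_le0 => /(_ Kc).
rewrite (fine_measure_diff muS mA); last by move=> x [].
rewrite (fine_measure_diff muS (measurable_slab v d)); last by move=> x [].
have := hd _ sv; set s := fine (mu (slab v d)) => hs.
have : (e + B) * s < (e + B) * a by rewrite ltr_pM2l//; lra.
have -> : (e + B) * a = e * M0 by rewrite /a mulrC divfK ?gt_eqF.
rewrite -/M0; lra.
Qed.

End AprioriVanishing.

(** * Existence of a minimizer *)

Section Minimizer.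
Context {R : realType} {m : nat}.
Notation V := 'rV[R]_m.+1.
Notation T := (borelRn R m.+1).
Notation X := (prod_topology (fun _ : V => R)).
Implicit Types (f g : V -> R) (K : set V) (u v xi : V).

Lemma gauge_ext f g x : (forall u, sphere u -> f u = g u) -> gauge f x = gauge g x.
Proof.
move=> fg; congr sup; apply/seteqP.
by split=> _ [u su <-]; exists u => //; rewrite fg.
Qed.

Lemma support_lipschitz K (M : R) x y : convex_body_o K ->
  (forall u, sphere u -> support_fun K u <= M) ->
  support_fun K x - support_fun K y <= m.+1%:R * M * `|x - y|.
Proof.
move=> bK KM; have [z Kz ->] := support_realized x bK.
have M0 : 0 <= M.
  have s0 := @sphere_delta R _ (ord0 : 'I_m.+1).
  by apply: le_trans (KM _ s0); apply/ltW/support_gt0.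
have zM : `|z| <= M.
  apply: normv_le => // i; have si := @sphere_delta R _ i.
  have h1 := le_trans (support_ge _ bK Kz) (KM _ si).
  have h2 := le_trans (support_ge _ bK Kz) (KM _ (sphereN si)).
  by move: h1 h2; rewrite dotvNl (dotvC _ z) dotv_delta ler_norml; lra.
apply: (@le_trans _ _ (dotv x z - dotv y z)); first by rewrite lerB// support_ge.
rewrite -dotvBl (le_trans (ler_norm _))// (le_trans (dotv_norm _ _))//.
by rewrite -mulrA -[leRHS]mulrA ler_wpM2l// mulrC ler_wpM2r.
Qed.

Lemma le_Rintegral_dist (nu : {measure set T -> \bar R}) f g d : sph_measure nu ->
  {within sphere, continuous f} -> {within sphere, continuous g} ->
  (forall u, sphere u -> `|f u - g u| <= d) ->
  `|\int[nu]_(u in (sphere : set T)) f u - \int[nu]_(u in (sphere : set T)) g u|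
    <= d * fine (nu sphere).
Proof.
move=> nuS fc gc fgd; have mS : measurable (sphere : set T) := measurable_sphere.
have fi := continuous_sph_integrable nuS fc; have gi := continuous_sph_integrable nuS gc.
have di := continuous_sph_integrable nuS (within_continuousB fc gc).
have ci (c : R) : nu.-integrable (sphere : set T) (EFin \o (fun=> c)).
  by apply: continuous_sph_integrable => //; apply: continuous_subspaceT; exact: cst_continuous.
rewrite -RintegralB// ler_norml -mulNr -!Rintegral_cst//.
by apply/andP; split; apply: le_Rintegral => // u /fgd; rewrite ler_norml => /andP[].
Qed.

Variables (lambda mu : {measure set T -> \bar R}) (Psi : V -> R -> R).
Hypotheses (lambdaS : sph_measure lambda) (muS : sph_measure mu).
Hypothesis Psi_inc : class_inc Psi.

Lemma Psi_t_bounded (r M : R) : 0 < r -> exists2 D, 0 < D &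
  forall u t, sphere u -> r <= t <= M -> `|Psi_t Psi u t| <= D.
Proof.
move=> r0.
have sub : sphere `*` `[r, M] `<=` @domSR R m.+1.
  by move=> [u t] /= [su]; rewrite in_itv/= => /andP[rt _]; split=> //=; exact: lt_le_trans rt.
have pc := continuous_subspaceW sub Psi_inc.1.2.2.
have [D [_ h]] := compact_bounded (continuous_compact pc (compact_setX compact_sphere (@segment_compact R r M))).
exists (`|D| + 1) => [|u t su rt]; first by rewrite ltr_wpDl.
apply: (h (`|D| + 1)); first by rewrite (le_lt_trans (ler_norm D))// ltrDl.
by exists (u, t) => //; split=> //=; rewrite in_itv.
Qed.

Lemma Psi_lipschitz u (r M D s t : R) : 0 < r ->
  (forall u t, sphere u -> r <= t <= M -> `|Psi_t Psi u t| <= D) ->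
  sphere u -> r <= s <= M -> r <= t <= M -> `|Psi u t - Psi u s| <= D * `|t - s|.
Proof.
move=> r0 hD su; wlog st : s t / s <= t.
  move=> W hs ht; case: (leP s t) => [st|/ltW ts]; first exact: W.
  by rewrite distrC (distrC t); exact: W.
move=> /andP[rs sM] /andP[rt tM].
have [c /andP[sc ct] ->] := Psi_MVT Psi_inc su (lt_le_trans r0 rs) st.
by rewrite normrM ler_wpM2r// hD// (le_trans rs)// (le_trans ct).
Qed.

Section Class.
Variables (r M : R).
Hypotheses (r0 : 0 < r) (r1 : r <= 1) (M1 : 1 <= M).

(** The bounds are imposed at every vector, so that the class sits in a product of segments; the
    Lipschitz and evenness conditions are closed for pointwise convergence and concern the sphere
    only. *)
Definition lip_class : set X := [set f | (forall x, r <= f x <= M) /\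
  (forall x y, sphere x -> sphere y ->
     f x - f y <= m.+1%:R * M * `|x - y| /\ f (- x) = f x)].

Lemma compact_lip_class : compact lip_class.
Proof.
pose B : set X := [set f | forall x, `[r, M]%classic (f x)].
pose C : set X := \bigcap_(p in (sphere `*` sphere : set (V * V)))
  ((fun f : X => f p.1 - f p.2) @^-1` [set t | t <= m.+1%:R * M * `|p.1 - p.2|] `&`
   (fun f : X => f (- p.1) - f p.1) @^-1` [set 0]).
rewrite (_ : lip_class = B `&` C).
  apply: compact_closedI.
    by apply: (@tychonoff V (fun=> R) (fun=> `[r, M]%classic)) => x; exact: segment_compact.
  have pc x : continuous (fun f : X => f x) by exact: (@proj_continuous V (fun=> R) x).
  apply: closed_bigI => p _; apply: closedI.
    apply: closed_comp; last exact: closed_le.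
    by move=> f _; apply: (@cvgB _ _ _ (nbhs f)); exact: pc.
  apply: closed_comp; last exact: closed_eq.
  by move=> f _; apply: (@cvgB _ _ _ (nbhs f)); exact: pc.
apply/seteqP; split=> f.
  move=> [h1 h2]; split=> [x|[x y] [/= sx sy]]; first by rewrite /= in_itv/=.
  have [h3 h4] := h2 _ _ sx sy; split=> //=.
  by rewrite h4 subrr.
move=> [h1 h2]; split=> [x|x y sx sy]; first by have := h1 x; rewrite /= in_itv/=.
have [h3 /= /subr0_eq h4] := h2 (x, y) (conj sx sy).
by split.
Qed.

Lemma lip_class_pos_cont (f : X) : lip_class f -> pos_cont f.
Proof.
move=> [h1 h2]; split=> [|u su]; last by have /andP[h _] := h1 u; exact: lt_le_trans h.
apply/within_sphere_continuousP => x sx.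
apply/(@cvgrPdist_le _ _ _ (within sphere (nbhs x)) _ f (f x)) => e e0.
pose L := m.+1%:R * M; have L0 : 0 < L by rewrite mulr_gt0// (lt_le_trans ltr01).
rewrite near_withinE; apply/nbhs_ballP; exists (e / L); first by rewrite /= divr_gt0.
move=> y; rewrite -ball_normE/= => /ltW xy sy.
have [h3 _] := h2 _ _ sx sy; have [h4 _] := h2 _ _ sy sx.
have : L * `|x - y| <= e by rewrite mulrC -ler_pdivlMr.
by move: h4; rewrite (distrC y) ler_norml -/L; move: h3; rewrite -/L; lra.
Qed.

(** The Ascoli step: for equi-Lipschitz functions, nearness at a point spreads to a ball of radius
    [e / 3 / L], and finitely many such balls cover the sphere. *)
Lemma lip_class_near (f0 : X) e : lip_class f0 -> 0 < e ->
  \forall f \near f0, lip_class f -> forall x, sphere x -> `|f x - f0 x| <= e.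
Proof.
move=> W0 e0.
have /compact_near_coveringP/near_covering_withinP cS := @compact_sphere R m.+1.
have e3 : 0 < e / 3 by rewrite divr_gt0.
pose L := m.+1%:R * M; have L0 : 0 < L by rewrite mulr_gt0// (lt_le_trans ltr01).
have := cS X (nbhs f0) (fun f x => lip_class f -> `|f x - f0 x| <= e) _.
move=> h; have {h} : \forall f \near f0, sphere `<=` [set x | lip_class f -> `|(f : X) x - f0 x| <= e].
  apply: h => x sx.
  exists (ball x (e / 3 / L), [set f : X | `|f0 x - f x| < e / 3]) => /=.
    split; first by apply: nbhsx_ballx; rewrite divr_gt0.
    have pc : (fun f : X => f x) @ f0 --> f0 x by exact: (@proj_continuous V (fun=> R) x f0).
    exact: (@cvgr_dist_lt _ _ _ (nbhs f0) _ (fun f : X => f x) (f0 x) pc _ e3).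
  move=> [y f] /=; rewrite -ball_normE/= => -[/ltW xy ff] sy [_ Wf].
  have [h1 _] := Wf _ _ sx sy; have [h2 _] := Wf _ _ sy sx.
  have [h3 _] := W0.2 _ _ sx sy; have [h4 _] := W0.2 _ _ sy sx.
  have : L * `|x - y| <= e / 3 by rewrite mulrC -ler_pdivlMr.
  move: ff h2 h4; rewrite (distrC y) ler_norml ltr_norml -/L; move: h1 h3; rewrite -/L; lra.
by apply: filterS => f h Wf x sx; exact: h.
Qed.

Lemma lip_class_continuous (F : X -> R) :
  (forall e, 0 < e -> exists2 d, 0 < d & forall f g : X, lip_class f -> lip_class g ->
     (forall x, sphere x -> `|f x - g x| <= d) -> `|F f - F g| <= e) ->
  {within lip_class, continuous F}.
Proof.
move=> hF; apply/subspace_continuousP => f0 W0.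
apply/(@cvgrPdist_le _ _ _ (within lip_class (nbhs f0)) _ F (F f0)) => e e0.
have [d d0 hd] := hF _ e0; rewrite near_withinE.
apply: filterS (lip_class_near W0 d0) => f h Wf.
by rewrite distrC; apply: hd => //; exact: h.
Qed.

(** At a maximizer [u] for [g], [f u <= g u + d <= (1 + d / r) * g u], so the two gauges differ at
    most by the factor [1 + d / r]. *)
Lemma ln_gauge_dist f g d xi : pos_cont f -> pos_cont g -> 0 < d -> sphere xi ->
  (forall u, sphere u -> r <= g u) -> (forall u, sphere u -> `|f u - g u| <= d) ->
  ln (gauge g xi) - ln (gauge f xi) <= d / r.
Proof.
move=> pf pg d0 sxi rg fgd.
have k0 : 0 < 1 + d / r by rewrite addr_gt0// divr_gt0.
apply: (@le_trans _ _ (ln (1 + d / r))); last by apply: le_ln1Dx; rewrite (lt_trans _ (divr_gt0 d0 r0))// ltrN10.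
rewrite lerBlDr -lnM ?posrE ?gauge_gt0// ler_ln ?posrE ?mulr_gt0 ?gauge_gt0//.
have [u su gu] := gaugeP xi pg.
have gu0 : 0 < g u by exact: pg.2.
have num0 : 0 < dotv u xi.
  by have := gauge_gt0 pg sxi; rewrite gu pmulr_lgt0 ?invr_gt0.
apply: (@le_trans _ _ ((1 + d / r) * (dotv u xi / f u))); last first.
  by rewrite ler_wpM2l ?(ltW k0)// gauge_ge.
rewrite gu mulrCA ler_pM2l// -[leLHS]mul1r ler_pdivlMr ?pf.2// mulrAC ler_pdivrMr// mul1r.
have := fgd _ su; rewrite ler_norml => /andP[_ h].
have : d <= d / r * g u by rewrite mulrAC ler_pdivlMr// ler_wpM2l ?(ltW d0)// rg.
lra.
Qed.

Lemma potential_continuous : {within lip_class, continuous (potential lambda : X -> R)}.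
Proof.
apply: lip_class_continuous => e e0.
have l0 := sph_mass_gt0 lambdaS.
pose d := e * r / fine (lambda sphere).
have d0 : 0 < d by rewrite divr_gt0 ?mulr_gt0.
exists d => // f g Wf Wg fgd.
have pf := lip_class_pos_cont Wf; have pg := lip_class_pos_cont Wg.
have -> : e = d / r * fine (lambda sphere).
  by rewrite /d; field; rewrite !gt_eqF.
apply: le_Rintegral_dist => //; [exact: ln_gauge_continuous|exact: ln_gauge_continuous|].
move=> u su; rewrite ler_norml lerNl opprB; apply/andP; split.
  by apply: ln_gauge_dist => // v sv; have /andP[] := Wg.1 v.
apply: ln_gauge_dist => // v sv; first by have /andP[] := Wf.1 v.
by rewrite distrC; exact: fgd.
Qed.

Lemma energy_continuous : {within lip_class, continuous (energy mu Psi : X -> R)}.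
Proof.
apply: lip_class_continuous => e e0.
have l0 := sph_mass_gt0 muS.
have [D D0 hD] := Psi_t_bounded M r0.
pose d := e / D / fine (mu sphere).
have d0 : 0 < d by rewrite !divr_gt0.
exists d => // f g Wf Wg fgd.
have pf := lip_class_pos_cont Wf; have pg := lip_class_pos_cont Wg.
have -> : e = D * d * fine (mu sphere).
  by rewrite /d; field; rewrite !gt_eqF.
apply: le_Rintegral_dist => //; [exact: Psi_comp_continuous|exact: Psi_comp_continuous|].
move=> u su; apply: (le_trans (Psi_lipschitz r0 hD su (Wg.1 u) (Wf.1 u))).
by rewrite ler_wpM2l ?(ltW D0)// fgd.
Qed.

End Class.

Lemma minimizer_exists : apriori_bounds lambda mu Psi ->
  exists K, [/\ convex_body_e K, energy mu Psi (support_fun K) <= energy mu Psi (fun=> 1) &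
    forall K', convex_body_e K' -> energy mu Psi (support_fun K') <= energy mu Psi (fun=> 1) ->
      potential lambda (support_fun K) <= potential lambda (support_fun K')].
Proof.
move=> [r [M [r0 r1 M1 hrM]]].
set c := energy mu Psi (fun=> 1).
have /closed_subspaceP[U cU UE] : closed ((energy mu Psi : X -> R) @^-1` [set t | t <= c] : set (subspace (lip_class r M))).
  by apply: closed_comp; [move=> f _; exact: energy_continuous|exact: closed_le].
pose W := lip_class r M `&` U.
have WE : W = lip_class r M `&` [set f : X | energy mu Psi f <= c].
  by rewrite /W setIC UE setIC.
have one_W : W (fun=> 1).
  rewrite WE; split; last exact: lexx.
  split=> [x|x y _ _]; first by rewrite r1 M1.
  by split=> //; rewrite subrr !mulr_ge0// (le_trans ler01).
have cW : compact W by apply: compact_closedI => //; exact: compact_lip_class.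
have pW : {within W, continuous (potential lambda : X -> R)}.
  by apply: continuous_subspaceW (potential_continuous r0 M1) => // f [].
have [|f + fmin] := compact_EVT_min _ cW pW; first by exists (fun=> 1).
rewrite inE WE => -[Lf /= fc].
have {}fmin (g : X) : W g -> potential lambda f <= potential lambda g.
  by move=> Wg; apply: fmin; rewrite inE.
have pf := lip_class_pos_cont r0 M1 Lf.
(* The minimizer [f] over the class may fail to be a support function; its Wulff shape has the same
   potential and no larger energy. *)
have bK := wulff_body pf.
have fe u : sphere u -> f (- u) = f u by move=> su; have [] := Lf.2 _ _ su su.
have eK := wulff_body_e pf fe.
have pK := support_pos_cont bK.
exists (wulff f); split; first exact: eK.
  by apply: le_trans fc; apply: energy_le => // u su; exact: support_wulff_le.
have -> : potential lambda (support_fun (wulff f)) = potential lambda f.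
  by apply: eq_Rintegral => xi; rewrite inE => sxi; rewrite gauge_support_wulff.
move=> K' eK' K'c.
(* A competitor of positive potential already loses against the unit ball, so the a priori bounds
   are invoked only for the others. *)
case: (leP (potential lambda (support_fun K')) 0) => [K'0|/ltW K'0]; last first.
  by apply: le_trans K'0; rewrite -(potential_cst1 lambda); exact: fmin.
have hb := hrM _ eK' K'c K'0.
(* A support function is unbounded off the sphere; the value 1 there puts it into [lip_class]
   without affecting either functional. *)
pose g : X := fun x => if x \in (sphere : set V) then support_fun K' x else 1.
have gE u : sphere u -> g u = support_fun K' u by move=> su; rewrite /g mem_set.
have -> : potential lambda (support_fun K') = potential lambda g.
  by apply: eq_Rintegral => xi _; congr ln; apply: gauge_ext => u su; rewrite gE.
apply: fmin; rewrite WE; split; last first.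
  rewrite /= (_ : energy mu Psi g = energy mu Psi (support_fun K'))//.
  by apply: eq_Rintegral => u; rewrite inE => su; rewrite gE.
split=> [x|x y sx sy].
  by rewrite /g; case: ifPn; [rewrite inE => /hb|rewrite r1 M1].
rewrite !gE//; last exact: sphereN.
split; last exact: support_even.
by apply: support_lipschitz => //; [exact: eK'.1|move=> u /hb/andP[]].
Qed.

End Minimizer.

(** * Bounded convergence for measures on the sphere *)

Section BoundedConvergence.
Context {R : realType} {m : nat}.
Notation V := 'rV[R]_m.+1.
Notation T := (borelRn R m.+1).

Lemma bounded_integrable (nu : {measure set T -> \bar R}) (D : set T) (F : T -> R) (M : R) :
  sph_measure nu -> measurable D -> measurable_fun D F ->
  (forall x, D x -> `|F x| <= M) -> nu.-integrable D (EFin \o F).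
Proof.
move=> nuS mD mF FM; apply: measurable_bounded_integrable => //.
  by rewrite -ge0_fin_numE// sph_mass_fin.
exists M; split; first exact: num_real.
by move=> M' MM' u su /=; rewrite (le_trans (FM _ su))// ltW.
Qed.

Lemma bounded_convergence (nu : {measure set T -> \bar R}) (D : set T)
    (F_ : nat -> T -> R) (F : T -> R) (M : R) :
  sph_measure nu -> measurable D -> (forall k, measurable_fun D (F_ k)) ->
  measurable_fun D F -> (forall k x, D x -> `|F_ k x| <= M) ->
  (forall x, D x -> F_ k x @[k --> \oo] --> F x) ->
  \int[nu]_(x in D) F_ k x @[k --> \oo] --> \int[nu]_(x in D) F x.
Proof.
move=> nuS mD mF_ mF FM FF.
have iM : nu.-integrable D (EFin \o (fun=> M)).
  by apply: (@bounded_integrable _ _ _ `|M|).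
have [||||intF _ h] := @dominated_convergence _ _ _ nu D mD (fun k => EFin \o F_ k)
    (EFin \o F) (EFin \o (fun=> M)) _ _ _ iM.
- by move=> k; apply/measurable_EFinP.
- exact/measurable_EFinP.
- by apply: aeW => x Dx; apply/fine_cvgP; split; [exact: nearW|exact: FF].
- by apply: aeW => x k Dx; rewrite /= lee_fin FM.
- apply: fine_cvg; rewrite fineK; first exact: h.
  exact: integrable_fin_num.
Qed.

End BoundedConvergence.

(** * First variation *)

Section EulerLagrange.
Context {R : realType} {m : nat}.
Notation V := 'rV[R]_m.+1.
Notation T := (borelRn R m.+1).
Variables (lambda mu : {measure set T -> \bar R}) (Psi : V -> R -> R).
Hypotheses (lambdaS : sph_measure lambda) (muS : sph_measure mu).
Hypothesis lambda_ac : abs_cont_sph lambda.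
Hypothesis Psi_inc : class_inc Psi.
Variable K : set V.
Hypothesis eK : convex_body_e K.
Let h := support_fun K.
Hypothesis K_min : forall K', convex_body_e K' ->
  energy mu Psi (support_fun K') <= energy mu Psi h ->
  potential lambda h <= potential lambda (support_fun K').

Let bK : convex_body_o K := eK.1.
Let ph : pos_cont h := support_pos_cont bK.
Let mS : measurable (sphere : set T) := measurable_sphere.
Let mD : measurable (regular_dir K : set T) := measurable_regular_dir bK.

Lemma multi_normal_null : lambda (multi_normal K) = 0%E.
Proof. by apply: lambda_ac; [exact: measurable_multi_normal|exact: sph_lebesgue_multi_normal]. Qed.

Lemma Rintegral_regular_dir (F : T -> R) : lambda.-integrable (sphere : set T) (EFin \o F) ->
  \int[lambda]_(x in (sphere : set T)) F x = \int[lambda]_(x in (regular_dir K : set T)) F x.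
Proof.
move=> iF; rewrite /Rintegral; congr fine; apply: (negligible_integral _ mS iF).
  exact: measurable_multi_normal.
exact: multi_normal_null.
Qed.

Lemma measurable_comp_alpha (g : V -> R) : {within sphere, continuous g} ->
  measurable_fun (regular_dir K : set T) (fun xi => g (alpha K xi)).
Proof.
move=> gc; apply: (@measurable_comp _ _ _ T T R (sphere : set T)) => //.
- move=> _ [xi [sxi _] <-]; have [] := alphaP bK sxi; done.
- exact: measurable_within_sphere.
- exact: measurable_alpha.
Qed.

Section Variation.
Variable g : V -> R.
Hypotheses (gc : {within sphere, continuous g}) (ge : forall u, sphere u -> g (- u) = g u).
Variable G : R.
Hypotheses (G0 : 0 < G) (gG : forall u, sphere u -> `|g u| <= G).

(** A sequence of parameters, as dominated convergence requires; the factor [(2 * G)^-1] keeps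
    [1 + t_ k * g] at least one half, so that [f_ k] stays positive. *)
Let t_ (k : nat) : R := (2 * G)^-1 * k.+1%:R^-1.
Let f_ k u := h u * (1 + t_ k * g u).

Let t_gt0 k : 0 < t_ k. Proof. by rewrite mulr_gt0 ?invr_gt0// mulr_gt0. Qed.

Let tG k : t_ k * G <= 2^-1.
Proof.
have -> : t_ k * G = 2^-1 * k.+1%:R^-1 by rewrite /t_; field; rewrite gt_eqF//= gt_eqF.
by rewrite -[leRHS]mulr1 ler_wpM2l// invf_le1// ler1n.
Qed.

Let tg k u : sphere u -> `|t_ k * g u| <= 2^-1.
Proof.
move=> su; rewrite normrM gtr0_norm ?t_gt0//; apply: le_trans (tG k).
by rewrite ler_wpM2l ?gG// ltW ?t_gt0.
Qed.

Let t_cvg : t_ k @[k --> \oo] --> (0 : R).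
Proof.
rewrite -(mulr0 (2 * G)^-1); apply: cvgM; first exact: cvg_cst.
exact: cvg_harmonic.
Qed.

Let pf k : pos_cont (f_ k).
Proof.
split.
  have hc := ph.1.
  apply/within_sphere_continuousP => x sx; apply: cvgM.
    by move/within_sphere_continuousP : hc; apply.
  apply: cvgD; first exact: cvg_cst.
  apply: cvgM; first exact: cvg_cst.
  by move/within_sphere_continuousP : gc; apply.
move=> u su; rewrite mulr_gt0 ?ph.2//.
have := tg k su; rewrite ler_norml => /andP[+ _]; lra.
Qed.

Let f_even k u : sphere u -> f_ k (- u) = f_ k u.
Proof. by move=> su; rewrite /f_ ge// /h support_even. Qed.

Let quot k u := (Psi u (f_ k u) - Psi u (h u)) / t_ k.

(** The mean value theorem between [h u] and [f_ k u], in either order; the intermediate point is as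
    close to [h u] as [f_ k u] may be. *)
Let quotE k u : sphere u -> exists2 c, `|c - h u| <= h u * (t_ k * G) &
  quot k u = Psi_t Psi u c * h u * g u.
Proof.
move=> su; have hu := ph.2 _ su; have fu := (pf k).2 _ su.
have t0 := t_gt0 k.
have fh : f_ k u - h u = t_ k * (h u * g u) by rewrite /f_; ring.
have dist : `|f_ k u - h u| <= h u * (t_ k * G).
  rewrite fh mulrCA normrM (gtr0_norm hu) normrM (gtr0_norm t0).
  by rewrite ler_wpM2l ?(ltW hu)// ler_wpM2l ?(ltW t0)// gG.
have [le|/ltW le] := leP (h u) (f_ k u).
  have [c /andP[c1 c2] E] := Psi_MVT Psi_inc su hu le.
  exists c; last first.
    by rewrite /quot E fh; field; rewrite gt_eqF.
  by apply: le_trans dist; rewrite !ger0_norm ?subr_ge0// lerB.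
have [c /andP[c1 c2] E] := Psi_MVT Psi_inc su fu le.
exists c; last first.
  rewrite /quot -opprB E -(opprB (f_ k u)) fh; field; by rewrite gt_eqF.
by apply: le_trans dist; rewrite !ler0_norm ?subr_le0// lerN2 lerB.
Qed.

Let quot_bounded : exists M, forall k u, sphere u -> `|quot k u| <= M.
Proof.
have [r [M [r0 M0 hrM]]] := pos_cont_bounds ph.
have r2 : 0 < r / 2 by rewrite divr_gt0.
(* The intermediate point lies within [h u / 2] of [h u], hence between [r / 2] and [2 * M]. *)
have [D D0 hD] := Psi_t_bounded Psi_inc (2 * M) r2.
exists (D * M * G) => k u su; have [c hc ->] := quotE k su.
have /andP[ru uM] := hrM _ su; have hu := ph.2 _ su.
have hc2 : `|c - h u| <= h u / 2.
  by apply: (le_trans hc); rewrite ler_wpM2l ?tG// ltW.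
rewrite !normrM (gtr0_norm hu) !ler_pM ?mulr_ge0 ?gG// ?(ltW hu)//.
by apply: hD => //; move: hc2; rewrite ler_norml; lra.
Qed.

Let quot_cvg u : sphere u -> quot k u @[k --> \oo] --> Psi_t Psi u (h u) * h u * g u.
Proof.
move=> su; have hu := ph.2 _ su.
have Pc : Psi_t Psi u c @[c --> h u] --> Psi_t Psi u (h u).
  have := Psi_inc.1.2.2 => /subspace_continuousP /(_ (u, h u) (conj su hu)) H.
  apply: (@cvg_trans _ ((fun p : V * R => Psi_t Psi p.1 p.2) @ within domSR (nbhs (u, h u)))) H.
  have pc : (u, c) @[c --> h u] --> (u, h u).
    exact: (@cvg_pair _ _ _ (nbhs (h u)) (nbhs u) (nbhs (h u)) _ _ _ (fun=> u) id (cvg_cst u) cvg_id).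
  move=> A /= hA; have := pc _ hA; rewrite /= /within/= !near_simpl => HA.
  near=> c; have : 0 < c by near: c; exact: lt_nbhsr.
  move=> c0; suff : domSR (u, c) -> A (Psi_t Psi u c) by apply.
  by near: c; exact: HA.
suff : (fun k => quot k u) @ \oo --> Psi_t Psi u (h u) * h u * g u by [].
have [gu0|gu0] := eqVneq (g u) 0.
  rewrite (_ : (fun k => quot k u) = fun=> 0); last first.
    by apply/funext => k; have [c _ ->] := quotE k su; rewrite gu0 mulr0.
  by rewrite gu0 mulr0; exact: cvg_cst.
have /choice[c_ hc_] k : exists c, `|c - h u| <= h u * (t_ k * G) /\
    quot k u = Psi_t Psi u c * h u * g u.
  by have [c h1 h2] := quotE k su; exists c.
rewrite (_ : (fun k => quot k u) = fun k => Psi_t Psi u (c_ k) * h u * g u); last first.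
  by apply/funext => k; have [_ ->] := hc_ k.
apply: cvgM; last exact: cvg_cst.
apply: cvgM; last exact: cvg_cst.
apply: (cvg_comp _ _ _ Pc).
apply/cvgrPdistC_le => e e0 /=.
have e1 : 0 < e / (h u * G) by rewrite divr_gt0 ?mulr_gt0.
have /cvgr_dist_le/(_ _ e1) := t_cvg; apply: filterS => k.
rewrite sub0r normrN (gtr0_norm (t_gt0 k)) ler_pdivlMr ?mulr_gt0// => hk.
by have [h1 _] := hc_ k; apply: (le_trans h1); rewrite mulrCA.
Unshelve. all: by end_near. Qed.

Let quot_continuous k : {within sphere, continuous (quot k)}.
Proof.
apply/within_sphere_continuousP => x sx; apply: cvgM; last exact: cvg_cst.
apply: cvgB.
  have := Psi_comp_continuous Psi_inc (pf k); move/within_sphere_continuousP; apply => //.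
have := Psi_comp_continuous Psi_inc ph; move/within_sphere_continuousP; apply => //.
Qed.

Lemma energy_derivative_continuous :
  {within sphere, continuous (fun u => Psi_t Psi u (h u) * h u * g u)}.
Proof.
apply/within_sphere_continuousP => x sx; apply: cvgM.
  apply: cvgM.
    have := Psi_t_comp_continuous Psi_inc ph; move/within_sphere_continuousP; apply => //.
  by have := ph.1; move/within_sphere_continuousP; apply.
by move/within_sphere_continuousP : gc; apply.
Qed.

Let energy_decreases :
  \int[mu]_(u in (sphere : set T)) (Psi_t Psi u (h u) * h u * g u) < 0 ->
  \forall k \near \oo, energy mu Psi (f_ k) <= energy mu Psi h.
Proof.
move=> Blt0; have [M hM] := quot_bounded.
have cv := @bounded_convergence _ _ mu sphere quot _ M muS mS
  (fun k => measurable_within_sphere (@quot_continuous k))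
  (measurable_within_sphere energy_derivative_continuous) hM quot_cvg.
have /cvgr_lt/(_ _ Blt0) := cv; apply: filterS => k.
rewrite /quot RintegralZr//; last first.
  apply: continuous_sph_integrable => //; apply: within_continuousB; apply: Psi_comp_continuous => //; exact: pf.
rewrite RintegralB//; last 2 first.
- by apply: continuous_sph_integrable => //; apply: Psi_comp_continuous => //; exact: pf.
- by apply: continuous_sph_integrable => //; exact: Psi_comp_continuous.
by rewrite pmulr_llt0 ?invr_gt0 ?t_gt0// subr_lt0 => /ltW.
Qed.

Let lquot k xi := (ln (gauge (f_ k) xi) - ln (gauge h xi)) / t_ k.

Let lquot_continuous k : {within sphere, continuous (lquot k)}.
Proof.
apply/within_sphere_continuousP => x sx; apply: cvgM; last exact: cvg_cst.
apply: cvgB.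
  have := ln_gauge_continuous (pf k); move/within_sphere_continuousP; apply => //.
have := ln_gauge_continuous ph; move/within_sphere_continuousP; apply => //.
Qed.

Let one_tg k u : sphere u -> 0 < 1 + t_ k * g u.
Proof. by move=> su; have := tg k su; rewrite ler_norml => /andP[+ _]; lra. Qed.

(** A normal of [K] at [xi] attains the gauge of [h] and serves as competitor in the gauge of
    [f_ k]. *)
Let lquot_ge k xi u : sphere xi -> normals K xi u -> - g u <= lquot k xi.
Proof.
move=> sxi /(normalsP _ bK sxi)[su hu]; rewrite /lquot ler_pdivlMr ?t_gt0//.
have E : gauge h xi / (1 + t_ k * g u) = dotv u xi / f_ k u.
  have h1 := one_tg k su; have h2 := ph.2 _ su.
  by rewrite hu /f_ -/h; field; rewrite !gt_eqF.
have : ln (gauge h xi / (1 + t_ k * g u)) <= ln (gauge (f_ k) xi).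
  rewrite ler_ln ?posrE ?divr_gt0 ?gauge_gt0// ?one_tg//.
  by rewrite E gauge_ge.
rewrite ln_div ?posrE ?gauge_gt0 ?one_tg//.
have : ln (1 + t_ k * g u) <= t_ k * g u.
  apply: le_ln1Dx; have := one_tg k su; lra.
lra.
Qed.

(** Conversely, a maximizer for [f_ k] serves as competitor in the gauge of [h]; the quadratic error
    of the logarithm leaves a term of order [t_ k]. *)
Let lquot_le k xi u : sphere xi -> sphere u -> gauge (f_ k) xi = dotv u xi / f_ k u ->
  lquot k xi <= - g u + 2 * G ^+ 2 * t_ k.
Proof.
move=> sxi su fu; rewrite /lquot ler_pdivrMr ?t_gt0//.
have E : gauge (f_ k) xi * (1 + t_ k * g u) = dotv u xi / h u.
  have h1 := one_tg k su; have h2 := ph.2 _ su.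
  by rewrite fu /f_; field; rewrite !gt_eqF.
have : ln (gauge (f_ k) xi * (1 + t_ k * g u)) <= ln (gauge h xi).
  rewrite ler_ln ?posrE ?mulr_gt0 ?gauge_gt0// ?one_tg//.
  by rewrite E gauge_ge.
rewrite lnM ?posrE ?gauge_gt0 ?one_tg//.
set x := t_ k * g u.
have x1 : 0 < 1 + x by exact: one_tg.
have : ln ((1 + x)^-1) <= - x / (1 + x).
  have E2 : (1 + x)^-1 = 1 + (- x / (1 + x)) by field; rewrite gt_eqF.
  rewrite [X in ln X]E2.
  apply: le_ln1Dx; rewrite ltr_pdivlMr//; lra.
rewrite lnV ?posrE//.
(* The difference times [1 + x] is [x ^+ 2 * (1 + 2 * x)], nonnegative since [x] is at least
   [- 2^-1]. *)
have : - x / (1 + x) <= - x + 2 * x ^+ 2.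
  rewrite ler_pdivrMr//.
  have : `|x| <= 2^-1 by exact: tg.
  rewrite ler_norml => /andP[x2 x3].
  have : 0 <= x ^+ 2 * (1 + 2 * x) by rewrite mulr_ge0 ?sqr_ge0//; lra.
  move=> h0; rewrite -subr_ge0.
  by rewrite (_ : _ - _ = x ^+ 2 * (1 + 2 * x))//; ring.
have : x ^+ 2 <= t_ k ^+ 2 * G ^+ 2.
  rewrite /x exprMn ler_wpM2l ?sqr_ge0// -(real_normK (num_real (g u))).
  by rewrite lerXn2r ?nnegrE ?(ltW G0)// gG.
rewrite /x; lra.
Qed.

Let lquot_bounded k xi : sphere xi -> `|lquot k xi| <= G + G.
Proof.
move=> sxi; have [u nu] := normals_exist bK sxi.
have [v sv fv] := gaugeP xi (pf k).
have := lquot_ge k sxi nu; have := lquot_le sxi sv fv.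
have := gG nu.1; have := gG sv; rewrite !ler_norml.
have h1 : 2 * G * (t_ k * G) <= 2 * G * 2^-1.
  by rewrite ler_wpM2l ?tG// mulr_ge0// ltW.
have h2 : 2 * G * 2^-1 = G by field.
have h3 : 2 * G ^+ 2 * t_ k = 2 * G * (t_ k * G) by ring.
rewrite h3; lra.
Qed.

(** Maximizers of the perturbed ratio can accumulate only at maximizers of the unperturbed one, that
    is, at the single normal. The sphere is covered by neighbourhoods of the normal and of points
    that are eventually not maximizers. *)
Let argmax_near xi e : regular_dir K xi -> 0 < e -> \forall k \near \oo, forall u,
  sphere u -> gauge (f_ k) xi = dotv u xi / f_ k u -> `|g u - g (alpha K xi)| <= e.
Proof.
move=> rxi e0; have sxi := rxi.1; have na := alphaP bK sxi; have sa := na.1.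
set a := alpha K xi in na sa *.
have /compact_near_coveringP/near_covering_withinP cS := @compact_sphere R m.+1.
suff : \forall k \near \oo, sphere `<=` [set u : V |
    gauge (f_ k) xi = dotv u xi / f_ k u -> `|g u - g a| <= e].
  by apply: filterS => k hk u su; exact: hk.
apply: cS => u su.
have [nu|nu] := pselect (normals K xi u).
  move/within_sphere_continuousP : gc => /(_ u su)/cvgr_distC_le/(_ _ e0).
  rewrite near_withinE => hu.
  exists ([set u' | sphere u' -> `|g u' - g u| <= e], setT) => /=.
    by split=> //; exact: filterT.
  by move=> [u' k] [/= hu' _] su' _; rewrite /a -(alpha_unique bK rxi nu) hu'.
have g0 := gauge_gt0 ph sxi; set y := gauge h xi in g0 *.
have qy : dotv u xi / h u < y.
  rewrite lt_neqAle gauge_ge// andbT; apply/eqP => E; apply: nu.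
  by apply/(normalsP _ bK sxi); split=> //; rewrite -/h -/y -E divfK// gt_eqF// ph.2.
(* A level strictly between the ratio at [u] and the gauge [y]; the maximum with 0 makes it
   positive. *)
pose q := (Num.max (dotv u xi / h u) 0 + y) / 2.
have my : Num.max (dotv u xi / h u) 0 < y by rewrite gt_max qy.
have m0 : 0 <= Num.max (dotv u xi / h u) 0 by rewrite le_max lexx orbT.
have mq : dotv u xi / h u <= Num.max (dotv u xi / h u) 0 by rewrite le_max lexx.
have q0 : 0 < q by rewrite /q; lra.
have qy' : q < y by rewrite /q; lra.
have uq : dotv u xi / h u < q by rewrite /q; lra.
have /within_sphere_continuousP/(_ u su)/cvgr_lt/(_ _ uq) := @ratio_continuous _ _ h xi ph.
rewrite near_withinE => hu.
(* For [t_ k] below this number, [q * (1 + t_ k * G) < y * (1 - t_ k * G)], so a point with ratio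
   below [q] loses to the normal [a]. *)
have d0 : 0 < (y - q) / (G * (y + q)).
  by rewrite divr_gt0 ?mulr_gt0 ?subr_gt0// addr_gt0.
have /cvgr_dist_lt/(_ _ d0) hk := t_cvg.
exists ([set u' | sphere u' -> dotv u' xi / h u' < q], [set k | `|0 - t_ k| < (y - q) / (G * (y + q))]) => //=.
move=> [u' k] /= [hu' tk] su' fu'; exfalso.
move: tk; rewrite sub0r normrN (gtr0_norm (t_gt0 k)) ltr_pdivlMr ?mulr_gt0 ?addr_gt0// => tk.
have tG0 := tG k; have t0 := t_gt0 k.
have a1 : 1 - t_ k * G <= 1 + t_ k * g u'.
  have : - (t_ k * G) <= t_ k * g u' by rewrite -mulrN ler_wpM2l ?(ltW t0)//; have := gG su'; rewrite ler_norml => /andP[].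
  lra.
have b1 : 1 + t_ k * g a <= 1 + t_ k * G.
  by rewrite lerD2l ler_wpM2l ?(ltW t0)//; have := gG sa; rewrite ler_norml => /andP[].
have au := one_tg k su'; have ba := one_tg k sa.
have E1 : gauge (f_ k) xi * (1 + t_ k * g u') < q.
  apply: le_lt_trans (hu' su'); rewrite le_eqVlt; apply/orP; left; apply/eqP.
  by have h2 := ph.2 _ su'; rewrite fu' /f_; field; rewrite !gt_eqF.
have E2 : y <= gauge (f_ k) xi * (1 + t_ k * g a).
  rewrite -ler_pdivrMr//; apply: le_trans (gauge_ge xi (pf k) sa).
  have [_ ha] := (normalsP _ bK sxi).1 na.
  have h2 := ph.2 _ sa; rewrite ha -/h -/y /f_ le_eqVlt; apply/orP; left; apply/eqP.
  by field; rewrite !gt_eqF.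
have E3 : y * (1 + t_ k * g u') < q * (1 + t_ k * g a).
  apply: (@le_lt_trans _ _ (gauge (f_ k) xi * (1 + t_ k * g a) * (1 + t_ k * g u'))).
    by rewrite ler_wpM2r// ltW.
  by rewrite mulrAC ltr_pM2r.
have E4 : y * (1 - t_ k * G) <= y * (1 + t_ k * g u') by rewrite ler_wpM2l// ltW.
have E5 : q * (1 + t_ k * g a) <= q * (1 + t_ k * G) by rewrite ler_wpM2l// ltW.
have : y * (1 - t_ k * G) < q * (1 + t_ k * G) by apply: le_lt_trans E4 _; apply: lt_le_trans E5.
have -> : y * (1 - t_ k * G) = y - t_ k * (G * y) by ring.
have -> : q * (1 + t_ k * G) = q + t_ k * (G * q) by ring.
move: tk; rewrite mulrDr mulrDr; lra.
Qed.

Let lquot_cvg xi : regular_dir K xi -> lquot k xi @[k --> \oo] --> - g (alpha K xi).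
Proof.
move=> rxi; have sxi := rxi.1; have na := alphaP bK sxi.
apply/cvgrPdistC_le => e e0 /=.
have e2 : 0 < e / 2 by rewrite divr_gt0.
have d0 : 0 < e / 2 / (2 * G ^+ 2) by rewrite divr_gt0// mulr_gt0// exprn_gt0.
near=> k.
have tk : 2 * G ^+ 2 * t_ k <= e / 2.
  rewrite mulrC -ler_pdivlMr ?mulr_gt0 ?exprn_gt0//.
  rewrite -(gtr0_norm (t_gt0 k)) -normrN -sub0r.
  by near: k; move/cvgr_dist_le : t_cvg => /(_ _ d0).
have [u su fu] := gaugeP xi (pf k).
have hu : `|g u - g (alpha K xi)| <= e / 2.
  have : forall u, sphere u -> gauge (f_ k) xi = dotv u xi / f_ k u -> `|g u - g (alpha K xi)| <= e / 2.
    by near: k; exact: argmax_near.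
  exact.
have h1 := lquot_ge k sxi na; have h2 := lquot_le sxi su fu.
by move: hu; rewrite !ler_norml; lra.
Unshelve. all: by end_near. Qed.

(** Otherwise the potential has derivative [- A < 0] along the perturbation while the energy
    decreases; for one [k] both drop, and the Wulff shape of [f_ k] contradicts minimality. *)
Lemma first_variation_le0 :
  \int[mu]_(u in (sphere : set T)) (Psi_t Psi u (h u) * h u * g u) < 0 ->
  \int[lambda]_(xi in (regular_dir K : set T)) g (alpha K xi) <= 0.
Proof.
move=> /energy_decreases en.
have malpha : measurable_fun (regular_dir K : set T) (fun xi => - g (alpha K xi)).
  by apply: measurableT_comp => //; exact: measurable_comp_alpha.
have sub : (regular_dir K : set T) `<=` sphere by move=> x [].
have cv := @bounded_convergence _ _ lambda (regular_dir K) lquot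
  (fun xi => - g (alpha K xi)) (G + G) lambdaS mD
  (fun k => measurable_funS mS sub (measurable_within_sphere (@lquot_continuous k)))
  malpha (fun k x rx => lquot_bounded k rx.1) lquot_cvg.
have ialpha : lambda.-integrable (regular_dir K : set T) (EFin \o (fun xi => g (alpha K xi))).
  apply: (@bounded_integrable _ _ _ _ _ G) => //; first exact: measurable_comp_alpha.
  by move=> x [sx _]; apply: gG; have [] := alphaP bK sx.
rewrite leNgt; apply/negP => A0.
have A1 : \int[lambda]_(xi in (regular_dir K : set T)) (- g (alpha K xi)) < 0.
  under eq_Rintegral do rewrite -mulN1r.
  by rewrite RintegralZl// mulN1r oppr_lt0.
have /cvgr_lt/(_ _ A1) neg := cv.
have [k [/= enk negk]] := filter_ex (filterI en neg).
have pfk := pf k.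
have := K_min (wulff_body_e pfk (f_even k)).
have -> : potential lambda (support_fun (wulff (f_ k))) = potential lambda (f_ k).
  by apply: eq_Rintegral => xi; rewrite inE => sxi; rewrite gauge_support_wulff.
move=> hmin.
have : potential lambda h <= potential lambda (f_ k).
  apply: hmin; apply: le_trans enk; apply: energy_le => //.
    by apply: support_pos_cont; exact: wulff_body.
  by move=> u su; exact: support_wulff_le.
apply/negP; rewrite -ltNge -subr_lt0.
move: negk; rewrite -Rintegral_regular_dir; last first.
  by apply: continuous_sph_integrable => //; exact: lquot_continuous.
rewrite /lquot RintegralZr//; last first.
  apply: continuous_sph_integrable => //; apply: within_continuousB; exact: ln_gauge_continuous.
rewrite RintegralB//; last 2 first.
- by apply: continuous_sph_integrable => //; exact: ln_gauge_continuous.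
- by apply: continuous_sph_integrable => //; exact: ln_gauge_continuous.
by rewrite pmulr_llt0 ?invr_gt0 ?t_gt0.
Qed.

End Variation.
End EulerLagrange.

(** * From the first variation to the identity of measures *)

Section EvenMeasure.
Context {R : realType} {m : nat}.
Notation V := 'rV[R]_m.+1.
Notation T := (borelRn R m.+1).
Variable nu : {measure set T -> \bar R}.
Hypotheses (nuS : sph_measure nu) (nuE : even_measure nu).

Let mopp : measurable_fun [set: T] ((fun x : V => - x) : T -> T).
Proof.
apply: (@measurability _ _ T T _ _ (@open V : set (set T)) erefl).
move=> _ [U oU <-]; rewrite setTI; apply: open_borel; apply: open_comp => // x _.
exact: opp_continuous.
Qed.

Lemma Rintegral_even (D : set V) (F : V -> R) (M : R) :
  measurable (D : set T) -> (forall x, D x -> D (- x)) ->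
  measurable_fun (D : set T) (F : T -> R) -> (forall x, D x -> `|F x| <= M) ->
  \int[nu]_(x in (D : set T)) F (- x) = \int[nu]_(x in (D : set T)) F x.
Proof.
move=> mD DN mF FM.
pose F' : T -> R := F \_ D.
have mF' : measurable_fun [set: T] F' by exact/(measurable_restrictT _ mD).
have DE (x : V) : ((- x : V) \in D) = (x \in D).
  by apply/idP/idP; rewrite !inE => /DN //; rewrite opprK.
have F'M x : `|F' x| <= `|M|.
  rewrite /F' patchE; case: ifPn => [|_]; last by rewrite normr0.
  by rewrite inE => /FM /le_trans; apply; exact: ler_norm.
rewrite Rintegral_mkcond [RHS]Rintegral_mkcond.
have -> : \int[nu]_(x in [set: T]) ((fun x : V => F (- x)) \_ D) x = \int[nu]_(x in [set: T]) F' (- (x : V)).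
  by apply: eq_Rintegral => x _; rewrite /F' !patchE DE.
rewrite /Rintegral; congr fine.
have mF'N : measurable_fun [set: T] (fun x : T => F' (- (x : V))).
  by apply: (measurableT_comp mF' mopp).
have iF : nu.-integrable [set: T] ((EFin \o F') \o ((fun x : V => - x) : T -> T)).
  by apply: (@bounded_integrable _ _ _ _ (fun x : T => F' (- (x : V))) `|M|).
have mEF : measurable_fun [set: T] (EFin \o F') by exact/measurable_EFinP.
rewrite -(@integral_pushforward _ _ T T R _ mopp nu setT (EFin \o F') mEF iF measurableT).
apply: eq_measure_integral => A mA _; rewrite /pushforward.
rewrite -[RHS](nuE mA); congr (nu _); apply/seteqP; split=> x.
  by move=> Ax; exists (- x : V) => //; rewrite opprK.
by move=> [y Ay <-] /=; rewrite opprK.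
Qed.

End EvenMeasure.

(** * Continuous approximation of indicators of open sets *)

Section OpenApproximation.
Context {R : realType} {m : nat}.
Notation V := 'rV[R]_m.+1.
Implicit Types (U C : set V) (x y : V).

Definition dist_to C x : R := inf [set `|x - y| | y in C].

Lemma dist_to_le C x y : C y -> dist_to C x <= `|x - y|.
Proof. by move=> Cy; apply: ge_inf; [exists 0 => _ [z _ <-]|exists y]. Qed.

Lemma dist_to_ge0 C x : C !=set0 -> 0 <= dist_to C x.
Proof.
by move=> [y Cy]; apply: lb_le_inf => [|_ [z _ <-]//]; exists `|x - y|, y.
Qed.

Lemma dist_to_lipschitz C x y : C !=set0 -> dist_to C x - dist_to C y <= `|x - y|.
Proof.
move=> [y0 Cy0]; rewrite lerBlDl -lerBlDr; apply: lb_le_inf.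
  by exists `|y - y0|, y0.
move=> _ [z Cz <-]; rewrite lerBlDr (le_trans (dist_to_le x Cz))//.
have -> : x - z = (y - z) + (x - y) by apply/rowP => i; rewrite !mxE; ring.
exact: ler_normD.
Qed.

Lemma dist_to_gt0 U x : open U -> U x -> ~` U !=set0 -> 0 < dist_to (~` U) x.
Proof.
rewrite openE => oU /oU /nbhs_ballP[e /= e0 eU] U0.
apply: (lt_le_trans e0); apply: lb_le_inf.
  by case: U0 => y Uy; exists `|x - y|, y.
move=> _ [z nUz <-]; rewrite leNgt; apply/negP => xz; apply: nUz; apply: eU.
by rewrite -ball_normE.
Qed.

Lemma open_indic_approx U : open U -> exists g_ : nat -> V -> R,
  [/\ forall k, continuous (g_ k), forall k x, 0 <= g_ k x <= 1 &
      forall x, g_ k x @[k --> \oo] --> (\1_U x : R)].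
Proof.
(* The whole space is treated apart: the infimum of the empty set is 0 by convention, so the
   distance formula would converge to 0 instead of 1. *)
move=> oU; have [U0|/set0P/negP] := pselect (~` U !=set0); last first.
  rewrite negbK => /eqP UC; exists (fun _ _ => 1); split => [k x|k x|x].
  - exact: cst_continuous.
  - by rewrite ler01 lexx.
  - rewrite indicE mem_set; first exact: cvg_cst.
    by apply: contrapT => nUx; have : (~` U) x by []; rewrite UC.
exists (fun k x => Num.min 1 (k%:R * dist_to (~` U) x)); split => [k x|k x|x].
- apply: (@lipschitz_continuous _ _ _ k%:R) => {}x y.
  have h : k%:R * dist_to (~` U) x - k%:R * dist_to (~` U) y <= k%:R * `|x - y|.
    by rewrite -mulrBr ler_wpM2l// dist_to_lipschitz.
  have h0 : 0 <= k%:R * `|x - y| by rewrite mulr_ge0.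
  by rewrite lerBlDr; case: (leP 1 (k%:R * dist_to (~` U) y)) => h1; rewrite ge_min; apply/orP; [left|right]; lra.
- by rewrite ge_min lexx /= le_min ler01 mulr_ge0// dist_to_ge0.
- rewrite indicE; have [|nUx] := boolP (x \in U).
    rewrite inE => Ux; have d0 := dist_to_gt0 oU Ux U0.
    apply: cvg_near_cst; near=> k; apply/eqP; rewrite eq_le ge_min lexx /= le_min lexx /=.
    rewrite -ler_pdivrMr// mul1r; near: k; exact: nbhs_infty_ger.
  have -> : dist_to (~` U) x = 0.
    apply/eqP; rewrite eq_le dist_to_ge0// andbT.
    have nUx' : (~` U) x by move=> Ux; move: nUx; rewrite mem_set.
    by apply: le_trans (dist_to_le x nUx') _; rewrite subrr normr0.
  by under eq_fun do rewrite mulr0 min_r//; exact: cvg_cst.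
Unshelve. all: by end_near. Qed.

End OpenApproximation.

(** * The Gauss image measure of a minimizer *)

Section MinimizerMeasure.
Context {R : realType} {m : nat}.
Notation V := 'rV[R]_m.+1.
Notation T := (borelRn R m.+1).
Variables (lambda mu : {measure set T -> \bar R}) (Psi : V -> R -> R).
Hypotheses (lambdaS : sph_measure lambda) (muS : sph_measure mu).
Hypotheses (lambdaE : even_measure lambda) (muE : even_measure mu).
Hypothesis lambda_ac : abs_cont_sph lambda.
Hypothesis Psi_inc : class_inc Psi.
Hypothesis Psi_even : forall xi t, sphere xi -> 0 < t -> Psi xi t = Psi (- xi) t.
Variable K : set V.
Hypothesis eK : convex_body_e K.
Let h := support_fun K.
Hypothesis K_min : forall K', convex_body_e K' ->
  energy mu Psi (support_fun K') <= energy mu Psi h ->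
  potential lambda h <= potential lambda (support_fun K').

Let bK : convex_body_o K := eK.1.
Let ph : pos_cont h := support_pos_cont bK.
Let mS : measurable (sphere : set T) := measurable_sphere.
Let mD : measurable (regular_dir K : set T) := measurable_regular_dir bK.

(** The rate of the constraint under [h (1 + t g)]; its reciprocal at the normal is the integrand of
    [Jtilde]. *)
Let w u := Psi_t Psi u (h u) * h u.

Let w_gt0 u : sphere u -> 0 < w u.
Proof. by move=> su; rewrite mulr_gt0 ?ph.2// Psi_inc.2// ph.2. Qed.

Let w_continuous : {within sphere, continuous w}.
Proof.
have c1 : {within sphere, continuous (fun _ : V => 1 : R)}.
  by apply: continuous_subspaceT; exact: cst_continuous.
have := energy_derivative_continuous Psi_inc eK c1.
by rewrite (_ : (fun u => _) = w)//; apply/funext => u; rewrite mulr1.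
Qed.

Lemma Psi_t_even u t : sphere u -> 0 < t -> Psi_t Psi (- u) t = Psi_t Psi u t.
Proof.
move=> su t0; rewrite /Psi_t !derive1E; apply: near_eq_derive.
by near=> s; rewrite -Psi_even//; near: s; exact: lt_nbhsr.
Unshelve. all: by end_near. Qed.

Let w_even u : sphere u -> w (- u) = w u.
Proof. by move=> su; rewrite /w /h support_even// Psi_t_even//; exact: ph.2. Qed.

Let alphaS xi : sphere xi -> sphere (alpha K xi).
Proof. by move=> sxi; have [] := alphaP bK sxi. Qed.

Let alphaN xi : regular_dir K xi -> regular_dir K (- xi) /\ alpha K (- xi) = - alpha K xi.
Proof.
move=> rxi; have sxi := rxi.1.
have rN : regular_dir K (- xi).
  split; first exact: sphereN.
  move=> [_ [u [v [nu nv uv]]]]; apply: rxi.2; split=> //.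
  exists (- u), (- v); split.
  - by have := normals_even eK (sphereN sxi) nu; rewrite opprK.
  - by have := normals_even eK (sphereN sxi) nv; rewrite opprK.
  - by rewrite eqr_opp.
split=> //; apply/esym; apply: alpha_unique => //.
by apply: normals_even => //; exact: alphaP.
Qed.

Let A (g : V -> R) := \int[lambda]_(xi in (regular_dir K : set T)) g (alpha K xi).
Let B (g : V -> R) := \int[mu]_(u in (sphere : set T)) (w u * g u).

Let integrable_alpha g : {within sphere, continuous g} ->
  lambda.-integrable (regular_dir K : set T) (EFin \o (fun xi => g (alpha K xi))).
Proof.
move=> gc; have [M _ gM] := continuous_sph_bounded gc.
apply: (@bounded_integrable _ _ _ _ _ M) => //; first exact: measurable_comp_alpha.
by move=> x [sx _]; apply: gM; exact: alphaS.
Qed.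

Let wg_continuous g : {within sphere, continuous g} -> {within sphere, continuous (fun u => w u * g u)}.
Proof. exact: energy_derivative_continuous. Qed.

Let AD g (s : R) : {within sphere, continuous g} ->
  A (fun u => g u + s) = A g + s * fine (lambda (regular_dir K)).
Proof.
move=> gc; rewrite /A RintegralD//; first by rewrite Rintegral_cst.
  exact: integrable_alpha.
by apply: (@bounded_integrable _ _ _ _ _ `|s|).
Qed.

Let B1_gt0 : 0 < B (fun=> 1).
Proof.
have [r [M [r0 _ rM]]] := pos_cont_bounds (conj w_continuous w_gt0).
apply: (@lt_le_trans _ _ (r * fine (mu sphere))); first by rewrite mulr_gt0// sph_mass_gt0.
rewrite -Rintegral_cst//; apply: le_Rintegral => //.
- by apply: (@bounded_integrable _ _ _ _ _ `|r|).
- apply: continuous_sph_integrable => //; apply: wg_continuous.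
  by apply: continuous_subspaceT; exact: cst_continuous.
- by move=> u /rM/andP[]; rewrite mulr1.
Qed.

Let BD g (s : R) : {within sphere, continuous g} ->
  B (fun u => g u + s) = B g + s * B (fun=> 1).
Proof.
move=> gc; have c1 : {within sphere, continuous (fun _ : V => 1 : R)}.
  by apply: continuous_subspaceT; exact: cst_continuous.
rewrite /B -RintegralZl//; last by apply: continuous_sph_integrable => //; exact: wg_continuous.
rewrite -RintegralD//.
- by apply: eq_Rintegral => u _; ring.
- by apply: continuous_sph_integrable => //; exact: wg_continuous.
- apply: continuous_sph_integrable => //.
  have := wg_continuous (continuous_subspaceT (@cst_continuous V R s) : {within sphere, continuous (fun _ : V => s : R)}).
  by rewrite (_ : (fun u => w u * s) = (fun u => s * (w u * 1)))//; apply/funext => u; ring.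
Qed.

Let tau := fine (lambda (regular_dir K)) / B (fun=> 1).

Let A_le g : {within sphere, continuous g} -> (forall u, sphere u -> g (- u) = g u) ->
  A g <= tau * B g.
Proof.
move=> gc ge; set l := fine (lambda (regular_dir K)).
have l0 : 0 <= l by exact: fine_ge0.
rewrite leNgt; apply/negP => lt; pose d := (A g - tau * B g) / (2 * (l + 1)).
have d0 : 0 < d by rewrite divr_gt0 ?subr_gt0// mulr_gt0// ltr_wpDl.
(* The shift makes [B (g + s) = - d * B 1] negative, while [A (g + s)] equals the assumed positive
   gap minus [d * l], at most half the gap by the choice of [d]. *)
pose s := - (B g / B (fun=> 1)) - d.
have gc' : {within sphere, continuous (fun u => g u + s)}.
  apply: within_continuousD => //; apply: continuous_subspaceT; exact: cst_continuous.
have [G G0 gG] := continuous_sph_bounded gc'.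
have ge' u : sphere u -> g (- u) + s = g u + s by move=> /ge ->.
have := first_variation_le0 lambdaS muS lambda_ac Psi_inc eK K_min gc' ge' G0 gG.
rewrite -/(B (fun u => g u + s)) -/(A (fun u => g u + s)) AD// BD// -/l.
have -> : B g + s * B (fun=> 1) = - (d * B (fun=> 1)).
  by rewrite /s; field; rewrite gt_eqF.
rewrite oppr_lt0 mulr_gt0// => /(_ isT).
have -> : A g + s * l = A g - tau * B g - d * l by rewrite /s /tau -/l; ring.
have : d * (2 * (l + 1)) = A g - tau * B g by rewrite divfK// gt_eqF// mulr_gt0// ltr_wpDl.
have : 0 <= d * l by rewrite mulr_ge0// ltW.
lra.
Qed.

Let A_eq g : {within sphere, continuous g} -> (forall u, sphere u -> g (- u) = g u) ->
  A g = tau * B g.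
Proof.
move=> gc ge; apply/eqP; rewrite eq_le A_le//=.
have gcN : {within sphere, continuous (fun u => - g u)}.
  by move=> x; apply: continuousN; exact: gc.
have := A_le gcN (fun u su => congr1 -%R (ge u su)).
have -> : A (fun u => - g u) = - A g.
  rewrite /A; under eq_Rintegral do rewrite -mulN1r.
  by rewrite RintegralZl ?mulN1r//; exact: integrable_alpha.
have -> : B (fun u => - g u) = - B g.
  rewrite /B; under eq_Rintegral do rewrite mulrN -mulN1r.
  by rewrite RintegralZl ?mulN1r//; apply: continuous_sph_integrable => //; exact: wg_continuous.
by rewrite mulrN lerN2.
Qed.

Let omega xi := (w (alpha K xi))^-1.

Let winv_continuous : {within sphere, continuous (fun u => (w u)^-1)}.
Proof.
apply/within_sphere_continuousP => x sx; apply: cvgV; first by rewrite gt_eqF// w_gt0.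
by have /within_sphere_continuousP := w_continuous; apply.
Qed.

Let gw_continuous (g : V -> R) : {within sphere, continuous g} -> {within sphere, continuous (fun u => g u / w u)}.
Proof.
move=> /within_sphere_continuousP gc; apply/within_sphere_continuousP => x sx.
apply: cvgM; first exact: gc.
by have /within_sphere_continuousP := winv_continuous; apply.
Qed.

Let regular_even (F : V -> R) M : measurable_fun (regular_dir K : set T) (F : T -> R) ->
  (forall x, regular_dir K x -> `|F x| <= M) ->
  \int[lambda]_(x in (regular_dir K : set T)) F (- x) =
  \int[lambda]_(x in (regular_dir K : set T)) F x.
Proof. by move=> mF FM; apply: (@Rintegral_even _ _ lambda lambdaS lambdaE _ _ M) => // x /alphaN[]. Qed.

(** Symmetrizing [g] doubles both sides, since the measures and [w] are even and [alpha] is odd on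
    regular directions; division by [w] removes the weight in [B]. *)
Let A_cont (g : V -> R) : continuous g -> A (fun u => g u / w u) = tau * \int[mu]_(u in (sphere : set T)) g u.
Proof.
move=> gc0; have gc : {within sphere, continuous g} by exact: continuous_subspaceT.
have gcN0 : continuous (fun u : V => g (- u)).
  by move=> x; apply: (@continuous_comp V V R (fun u : V => - u) g x); [exact: opp_continuous|exact: gc0].
have gcN : {within sphere, continuous (fun u : V => g (- u))} by exact: continuous_subspaceT.
pose ge (u : V) := g u + g (- u).
have gec : {within sphere, continuous ge} by exact: within_continuousD.
have := A_eq (gw_continuous gec).
have ge_even u : sphere u -> ge (- u) / w (- u) = ge u / w u.
  by move=> su; rewrite w_even// /ge opprK addrC.
move=> /(_ ge_even).
have -> : A (fun u => ge u / w u) = 2 * A (fun u => g u / w u).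
  have -> : A (fun u => ge u / w u) = A (fun u => g u / w u) + A (fun u : V => g (- u) / w u).
    rewrite /A -RintegralD//; last 2 first.
    - by apply: (integrable_alpha (gw_continuous gc)).
    - by apply: (integrable_alpha (gw_continuous gcN)).
    by apply: eq_Rintegral => x _; rewrite /ge mulrDl.
  have [M _ hM] := continuous_sph_bounded (gw_continuous gc).
  have -> : A (fun u : V => g (- u) / w u) = A (fun u => g u / w u).
    rewrite /A -(@regular_even (fun xi => g (alpha K xi) / w (alpha K xi)) M).
    - apply: eq_Rintegral => x; rewrite inE => rx; have [_ ->] := alphaN rx.
      by rewrite w_even//; exact: alphaS rx.1.
    - exact: (measurable_comp_alpha eK (gw_continuous gc)).
    - by move=> x rx; apply: hM; exact: alphaS rx.1.
  ring.
have -> : B (fun u => ge u / w u) = 2 * \int[mu]_(u in (sphere : set T)) g u.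
  have -> : B (fun u => ge u / w u) = \int[mu]_(u in (sphere : set T)) (g u + g (- u)).
    apply: eq_Rintegral => u; rewrite inE => su; rewrite /ge mulrC divfK// gt_eqF// w_gt0//.
  rewrite RintegralD//; last 2 first.
  - exact: continuous_sph_integrable.
  - exact: continuous_sph_integrable.
  have [M _ hM] := continuous_sph_bounded gc.
  rewrite (@Rintegral_even _ _ mu muS muE _ g M) //.
  - by ring.
  - by move=> x; exact: sphereN.
  - exact: measurable_within_sphere.
by move=> E; apply: (mulfI (_ : 2 != 0 :> R)) => //; rewrite E; ring.
Qed.

Let tau_gt0 : 0 < tau.
Proof.
have c1 : continuous (fun _ : V => 1 : R) by exact: cst_continuous.
have := @sph_mass_gt0 _ _ lambda lambdaS.
have -> : fine (lambda sphere) = fine (lambda (regular_dir K)).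
  have := @Rintegral_regular_dir _ _ lambda lambda_ac K eK (fun=> 1) _.
  rewrite !Rintegral_cst// !mul1r; apply.
  by apply: continuous_sph_integrable => //; exact: continuous_subspaceT.
by move=> l0; rewrite divr_gt0.
Qed.

Let preim (S : set V) : set V := regular_dir K `&` alpha K @^-1` S.

Let mpreim (S : set T) : measurable S -> measurable (preim S : set T).
Proof. by move=> mSS; exact: (measurable_alpha bK). Qed.

Let momega : measurable_fun (regular_dir K : set T) (omega : T -> R).
Proof. exact: (measurable_comp_alpha eK winv_continuous). Qed.

Let momegaE (S : set T) : measurable S -> measurable_fun (preim S : set T) (EFin \o omega).
Proof.
by move=> mSS; apply/measurable_EFinP; apply: (measurable_funS mD) momega => x [].
Qed.

Let omega_ge0 xi : regular_dir K xi -> 0 <= omega xi.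
Proof. by move=> rxi; rewrite invr_ge0 ltW// w_gt0//; exact: alphaS rxi.1. Qed.

Let transport_open (U : set V) : open U ->
  (\int[lambda]_(xi in (preim U : set T)) (omega xi)%:E = tau%:E * mu U)%E.
Proof.
move=> oU; have [g_ [gc g01 gU]] := open_indic_approx oU.
have mU : measurable (U : set T) by exact: open_borel.
have [W W0 hW] := continuous_sph_bounded winv_continuous.
have gbound k u : `|g_ k u| <= 1.
  by have /andP[? ?] := g01 k u; rewrite ger0_norm.
have indb (u : V) : `|(\1_U u : R)| <= 1.
  by rewrite indicE; case: (u \in U); rewrite ?normr1 ?normr0.
have mi (D : set T) : measurable_fun D (\1_U : T -> R) by exact: measurable_indic.
have malpha1 : measurable_fun (regular_dir K : set T) (fun xi => \1_U (alpha K xi) : R).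
  apply: (@measurable_comp _ _ _ T T R setT) => //.
  exact: measurable_alpha.
have cv1 := @bounded_convergence _ _ lambda (regular_dir K)
  (fun k xi => g_ k (alpha K xi) / w (alpha K xi)) (fun xi => \1_U (alpha K xi) * omega xi) W lambdaS mD.
have cv2 := @bounded_convergence _ _ mu sphere (fun k => g_ k) (\1_U : T -> R) 1 muS mS.
have {}cv1 : A (fun u => g_ k u / w u) @[k --> \oo] -->
    \int[lambda]_(xi in (regular_dir K : set T)) (\1_U (alpha K xi) * omega xi).
  apply: cv1.
  - by move=> k; exact: (measurable_comp_alpha eK (gw_continuous (continuous_subspaceT (gc k)))).

  - exact: (measurable_funM malpha1 momega).
  - move=> k x rx; rewrite normrM -[leRHS]mul1r ler_pM// hW//; exact: alphaS rx.1.
  - by move=> x rx; apply: cvgM; [exact: gU|exact: cvg_cst].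
have {}cv2 : \int[mu]_(u in (sphere : set T)) g_ k u @[k --> \oo] -->
    \int[mu]_(u in (sphere : set T)) \1_U u.
  apply: cv2 => //.
  by move=> k; apply: measurable_within_sphere; exact: continuous_subspaceT.
have E : \int[lambda]_(xi in (regular_dir K : set T)) (\1_U (alpha K xi) * omega xi) =
    tau * \int[mu]_(u in (sphere : set T)) \1_U u.
  rewrite -(cvg_lim (@Rhausdorff R) cv1); apply/cvg_lim; first exact: Rhausdorff.
  rewrite (_ : (fun k => A _) = fun k => tau * \int[mu]_(u in (sphere : set T)) g_ k u).
    by apply: cvgM; [exact: cvg_cst|exact: cv2].
  by apply/funext => k; exact: A_cont.
have muU : \int[mu]_(u in (sphere : set T)) \1_U u = fine (mu U).
  rewrite /Rintegral integral_indic// setIC; congr fine.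
  rewrite setIC; apply/esym; rewrite -[in LHS](setIT U) -(setUv sphere) setIUr measureU//.
  - have [nu0 _] := muS.
    rewrite [X in (_ + X)%E](_ : _ = 0%E) ?adde0//.
    apply/eqP; rewrite eq_le measure_ge0 andbT -(nu0 : mu (~` sphere) = 0%E).
    by apply: le_measure; rewrite ?inE; [apply: measurableI => //; exact: measurableC|exact: measurableC|move=> x []].
  - exact: measurableI.
  - by apply: measurableI => //; exact: measurableC.
  - by rewrite setIACA setICr setI0.
rewrite muU in E.
rewrite -[mu U]fineK ?sph_mass_fin// -EFinM -E /Rintegral fineK.
  rewrite /preim integral_mkcondr; apply: eq_integral => x _.
  rewrite patchE indicE /=.
  have -> : (x \in alpha K @^-1` U) = (alpha K x \in U) by apply/idP/idP; rewrite !inE.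
  by case: ifPn => _ /=; rewrite ?mul1r ?mul0r.
apply: integrable_fin_num => //.
apply: (@bounded_integrable _ _ _ _ (fun xi => \1_U (alpha K xi) * omega xi) W) => //.
  exact: (measurable_funM malpha1 momega).
by move=> x rx; rewrite normrM -[leRHS]mul1r ler_pM// hW//; exact: alphaS rx.1.
Qed.

(** Open sets are stable under intersection and generate the Borel sets, so Dynkin's theorem extends
    [transport_open]; complements are handled by subtracting the finite quantity [tau * mu S']. *)
Lemma transport (S : set T) : measurable S ->
  (\int[lambda]_(xi in (preim S : set T)) (omega xi)%:E = tau%:E * mu S)%E.
Proof.
move=> mSS; apply: (@dynkin_induction _ T (@open V : set (set T))
  (fun S : set T => \int[lambda]_(xi in (preim S : set T)) (omega xi)%:E = tau%:E * mu S)%E) => //.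
- by move=> U W; exact: openI.
- by apply: transport_open; exact: openT.
- move=> S' mS' E; have mSC : measurable (~` S') by exact: measurableC.
  have tot := transport_open openT.
  have splitT : preim setT = preim S' `|` preim (~` S').
    apply/seteqP; split=> [x [rx _]|x [[rx _]|[rx _]]] //.
    by have [hx|hx] := pselect (S' (alpha K x)); [left|right].
  move: tot; rewrite splitT ge0_integral_setU//; last 5 first.
  - exact: mpreim.
  - by apply: mpreim; exact: measurableC.
  - by rewrite -splitT; apply: momegaE; exact: measurableT.
  - by move=> x [[rx _]|[rx _]]; rewrite lee_fin omega_ge0.
  - by apply/disj_setPS => x [[_ hx] [_ /(_ hx)]].
  rewrite E -(setUv S') measureU ?setICr//.
  rewrite muleDr ?fin_num_adde_defl ?sph_mass_fin//.
  rewrite ![(tau%:E * mu S' + _)%E]addeC => /(congr1 (fun z => (z - tau%:E * mu S')%E)).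
  by rewrite !addeK// fin_numM ?sph_mass_fin.
- move=> F mF tF E.
  have bigE : preim (\bigcup_k F k) = \bigcup_k preim (F k).
    apply/seteqP; split=> [x [rx [k _ Fk]]|x [k _ [rx Fk]]]; first by exists k.
    by split=> //; exists k.
  rewrite bigE ge0_integral_bigcup; last 4 first.
  - by move=> k; exact: mpreim.
  - by rewrite -bigE; apply: momegaE; exact: bigcupT_measurable.
  - by move=> x [k _ [rx _]]; rewrite lee_fin omega_ge0.
  - move=> i j _ _ [x [[_ xi] [_ xj]]]; apply: (tF i j) => //.
    by exists (alpha K x).
  rewrite measure_semi_bigcup//; last exact: bigcupT_measurable.
  by rewrite -nneseriesZl//; apply: eq_eseriesr => k _; exact: E.
Qed.

(** [alpha_star K S] and [preim S] agree off the null set [multi_normal K]. Measurability of the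
    former is not established, hence the comparison of integrals off a null set. *)
Lemma Jtilde_minimizer : exists2 t : R, 0 < t & forall S : set T, measurable S ->
  (Jtilde Psi lambda K S = t%:E * mu S)%E.
Proof.
exists tau => // S mSS; rewrite -transport// /Jtilde.
rewrite integral_mkcond [RHS]integral_mkcond.
have off_null := eq_integral_off_null (measurable_multi_normal bK) (multi_normal_null lambda_ac eK).
refine (off_null _ _ _).
move=> x nx; rewrite !patchE.
have -> : (x \in alpha_star K S) = (x \in preim S).
  apply/idP/idP; rewrite !inE.
    move=> hx; have rx : regular_dir K x by split=> //; exact: hx.1.
    by split=> //; apply/(alpha_starE _ bK rx).
  by move=> [rx hx]; apply/alpha_starE.
by case: ifPn => // _; rewrite /omega /w mul1r mulrC.
Qed.

End MinimizerMeasure.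

(** * Existence in both cases, and necessity *)

Section Solutions.
Context {R : realType} {m : nat}.
Notation V := 'rV[R]_m.+1.
Notation T := (borelRn R m.+1).
Implicit Types (lambda mu : {measure set T -> \bar R}) (Psi : V -> R -> R) (K : set V).

(** The factor is only required to be nonzero: it is negative for decreasing [Psi] and cancels in
    the quotient. *)
Lemma normalized_eq_of_proportional lambda mu Psi K (t : R) : sph_measure mu -> t != 0 ->
  (forall S : set T, measurable S -> (Jtilde Psi lambda K S = t%:E * mu S)%E) ->
  normalized_eq Psi lambda mu K.
Proof.
move=> muS t0 JE; have mS : measurable (sphere : set T) := measurable_sphere.
have b0 := sph_mass_gt0 muS.
have bE := fineK (sph_mass_fin muS mS).
have JS : Jtilde Psi lambda K sphere = (t * fine (mu sphere))%:E by rewrite JE// EFinM bE.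
have tb0 : t * fine (mu sphere) != 0 by rewrite mulf_neq0// gt_eqF.
rewrite /normalized_eq JS; split=> //; split; first by rewrite eqe.
move=> w mw _; rewrite JE// sph_mass// -bE -(fineK (sph_mass_fin muS mw)).
rewrite !inver gt_eqF//= (negbTE tb0) -!EFinM; congr EFin.
by field; rewrite t0 gt_eqF.
Qed.

Lemma increasing_solution lambda mu Psi :
  sph_measure lambda -> sph_measure mu -> even_measure lambda -> even_measure mu ->
  abs_cont_sph lambda -> class_inc Psi ->
  (forall xi t, sphere xi -> 0 < t -> Psi xi t = Psi (- xi) t) ->
  apriori_bounds lambda mu Psi ->
  exists2 K, convex_body_e K & exists2 t : R, 0 < t &
    forall S : set T, measurable S -> (Jtilde Psi lambda K S = t%:E * mu S)%E.
Proof.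
move=> lS muS lE muE lac Pinc Peven ap.
have [K [eK Kc Kmin]] := minimizer_exists lS muS Pinc ap.
exists K; first exact: eK.
apply: (Jtilde_minimizer lS muS lE muE lac Pinc Peven eK) => K' eK' K'h.
by apply: (Kmin _ eK'); exact: le_trans Kc.
Qed.

Lemma Psi_t_opp Psi u t : class_C Psi -> sphere u -> 0 < t ->
  Psi_t (fun v s => - Psi v s) u t = - Psi_t Psi u t.
Proof. by move=> [_ [Pd _]] su t0; rewrite /Psi_t -derive1N//; exact: Pd. Qed.

Lemma class_inc_opp Psi : class_Cd Psi -> class_inc (fun u t => - Psi u t).
Proof.
move=> [PC Pneg]; have [Pc [Pd Ptc]] := PC; split; last first.
  by move=> u t su t0; rewrite Psi_t_opp// oppr_gt0 Pneg.
split.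
  apply/subspace_continuousP => p dp; apply: cvgN.
  by move/subspace_continuousP : Pc; apply.
split; first by move=> u t su t0; apply: derivableN; exact: Pd.
have h : {within @domSR R m.+1, continuous (fun p : V * R => - Psi_t Psi p.1 p.2)}.
  apply/subspace_continuousP => p dp; apply: cvgN.
  by move/subspace_continuousP : Ptc; apply.
apply: (subspace_eq_continuous _ h) => p; rewrite inE => -[sp tp].
exact/esym/Psi_t_opp.
Qed.

Lemma Jtilde_opp lambda Psi K (S : set V) : convex_body_o K -> class_Cd Psi ->
  Jtilde Psi lambda K S = (- Jtilde (fun u t => - Psi u t)%R lambda K S)%E.
Proof.
move=> bK Cd; have Pinc := class_inc_opp Cd; have pK := support_pos_cont bK.
rewrite /Jtilde -integral_ge0N.
  apply: eq_integral => xi; rewrite inE => -[sxi _].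
  have [sa _] := alphaP bK sxi; have ha := pK.2 _ sa.
  by rewrite (Psi_t_opp Cd.1 sa ha) -EFinN mulrN invrN mulrN opprK.
move=> xi [sxi _]; have [sa _] := alphaP bK sxi; have ha := pK.2 _ sa.
by rewrite lee_fin divr_ge0// mulr_ge0// ltW//; exact: Pinc.2.
Qed.

(** If [nu] lived on the subsphere orthogonal to [v], [Jtilde] would vanish off it. But directions
    near [v] have normals not orthogonal to [v], the integrand is bounded below, and [lambda]
    charges a neighbourhood of [v]. *)
Lemma not_concentrated_of_solution lambda nu Psi K : sph_measure nu ->
  positive_on_open lambda -> class_inc Psi -> convex_body_o K ->
  normalized_eq Psi lambda nu K -> not_concentrated nu.
Proof.
move=> nuS lpos Pinc bK [Jfin [J0 JE]] v sv; have pK := support_pos_cont bK.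
pose w : set V := sphere `\` great_subsphere v.
have mw : measurable (w : set T).
  by apply: measurableD; [exact: measurable_sphere|exact: measurable_great_subsphere].
rewrite lt_neqAle measure_ge0 andbT eq_sym; apply/negP => /eqP nuw0.
have := JE w mw (fun x h => h.1); rewrite nuw0 mul0e => /esym/eqP; rewrite mule_eq0.
have [b bE] : exists b, Jtilde Psi lambda K sphere = b%:E.
  by exists (fine (Jtilde Psi lambda K sphere)); rewrite fineK.
rewrite bE eqe in J0; rewrite bE inver (negbTE J0) eqe invr_eq0 (negbTE J0) orbF => /eqP Jw0.
have [r [M [r0 M0 rM]]] := pos_cont_bounds pK.
have [D D0 hD] := Psi_t_bounded Pinc M r0.
(* A normal orthogonal to [v] would have product with [xi] at most [m.+1%:R] times the distance from
   [xi] to [v], hence below the bound [r / M] of [normal_dot_ge]. *)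
pose eta := r / M / m.+1%:R.
have eta0 : 0 < eta by rewrite !divr_gt0.
pose U : set V := ball v eta.
have oU : open U by exact: ball_open.
have mUS : measurable (U `&` sphere : set T).
  by apply: measurableI; [exact: open_borel|exact: measurable_sphere].
have UStar : U `&` sphere `<=` alpha_star K w.
  move=> xi [xiU sxi]; split=> //; exists (alpha K xi).
  have na := alphaP bK sxi; have sa := na.1; split=> //; split=> // -[_ va0].
  have := normal_dot_ge bK sxi na r0 rM.
  have -> : dotv (alpha K xi) xi = dotv (alpha K xi) (xi - v).
    by rewrite dotvBr (dotvC _ v) va0 subr0.
  apply/negP; rewrite -ltNge; apply: (le_lt_trans (ler_norm _)).
  apply: (le_lt_trans (dotv_norm _ _)).
  apply: (@le_lt_trans _ _ (m.+1%:R * 1 * `|xi - v|)).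
    by rewrite ler_wpM2r// ler_wpM2l// sphere_norm.
  move: xiU; rewrite /U -ball_normE/= distrC mulr1 mulrC => h.
  by rewrite -ltr_pdivlMr.
have lUS : (0 < lambda (U `&` sphere))%E.
  by apply: lpos => //; exists v; split=> //; exact: ballxx.
have integrand xi : alpha_star K w xi ->
    (M * D)^-1 <= 1 / (support_fun K (alpha K xi) * Psi_t Psi (alpha K xi) (support_fun K (alpha K xi))).
  move=> [sxi _]; have [sa _] := alphaP bK sxi; have ha := pK.2 _ sa.
  have pa := Pinc.2 _ _ sa ha; have /andP[_ hM] := rM _ sa.
  rewrite div1r lef_pV2 ?posrE ?mulr_gt0// ler_pM// ?(ltW ha) ?(ltW pa)//.
  by have := hD _ _ sa (rM _ sa); rewrite gtr0_norm.
have MD0 : 0 < (M * D)^-1 by rewrite invr_gt0 mulr_gt0.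
have : ((M * D)^-1%:E * lambda (U `&` sphere) <= Jtilde Psi lambda K w)%E.
  rewrite -integral_cst// /Jtilde integral_mkcond [leRHS]integral_mkcond.
  have le := @ge0_le_integral_off_null _ T R lambda _ _ set0 measurable0 (measure0 lambda).
  apply: le.
  - by move=> x; rewrite patchE; case: ifPn => // _; rewrite lee_fin ltW.
  - move=> x; rewrite patchE; case: ifPn => //; rewrite inE => hx.
    by rewrite lee_fin (le_trans (ltW MD0))// integrand.
  - move=> x _; rewrite !patchE; case: ifPn => [|_].
      by rewrite inE => /UStar hx; rewrite mem_set// lee_fin integrand.
    case: ifPn => //; rewrite inE => hx.
    by rewrite lee_fin (le_trans (ltW MD0))// integrand.
rewrite Jw0 leNgt => /negP; apply; exact: mule_gt0.
Qed.

End Solutions.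

Unset Implicit Arguments.

Theorem theorem6p4 (R : realType) (n : nat) (hn : (2 <= n)%N)
  (lambda mu : {measure set borelRn R n -> \bar R}) (Psi : 'rV[R]_n -> R -> R) :
  (* lambda in M, even, not concentrated on any great subsphere *)
  sph_measure lambda -> abs_cont_sph lambda -> even_measure lambda ->
  not_concentrated lambda ->
  (* mu nonzero finite even Borel measure on S^{n-1}, not concentrated *)
  sph_measure mu -> even_measure mu -> not_concentrated mu ->
  (* Psi in C, even in the first variable *)
  class_C Psi ->
  (forall xi t, sphere xi -> 0 < t -> Psi xi t = Psi (- xi) t) ->
  (* (i) *)
  (class_GI Psi ->
     (exists K, convex_body_e K /\ normalized_eq Psi lambda mu K) /\
     (positive_on_open lambda ->
        forall nu : {measure set borelRn R n -> \bar R},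
          sph_measure nu -> even_measure nu ->
          (exists K, convex_body_e K /\ normalized_eq Psi lambda nu K) ->
          not_concentrated nu)) /\
  (* (ii) *)
  (vanishes_on_great_subspheres mu ->
   (exists C : R, (C%:E < ereal_inf
        [set (\int[lambda]_(xi in (sphere : set (borelRn R n))) logabs v xi)%E
         | v in sphere])%E) ->
   class_Cd Psi ->
   exists K, convex_body_e K /\ normalized_eq Psi lambda mu K).
Proof.
case: n hn lambda mu Psi => [//|m] _ lambda mu Psi lS lac lE lnc muS muE mnc PC Peven.
split=> [[_ [Ppos [Pinc [_ Pinf]]]]|mvan [C hC] Cd].
  have cinc : class_inc Psi by [].
  split=> [|lpos nu nuS _ [K [eK nK]]]; last first.
    exact: not_concentrated_of_solution lpos cinc eK.1 nK.
  have ap := apriori_increasing lS muS cinc lnc mnc Ppos Pinf.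
  have [K eK [t t0 hJ]] := increasing_solution lS muS lE muE lac cinc Peven ap.
  by exists K; split=> //; apply: (normalized_eq_of_proportional muS _ hJ); rewrite gt_eqF.
have cinc := class_inc_opp Cd.
have Neven xi t : sphere xi -> 0 < t -> - Psi xi t = - Psi (- xi) t.
  by move=> sxi t0; rewrite Peven.
have ap := apriori_vanishing lS muS cinc mvan hC.
have [K eK [t t0 hJ]] := increasing_solution lS muS lE muE lac cinc Neven ap.
(* [Jtilde] is odd in [Psi], so the factor found for the negative of [Psi] reappears with opposite
   sign. *)
exists K; split=> //; apply: (@normalized_eq_of_proportional _ _ _ _ _ _ (- t) muS).
  by rewrite oppr_eq0 gt_eqF.
by move=> S mS; rewrite (Jtilde_opp _ _ eK.1 Cd) hJ// EFinN mulNe.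
Qed.
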